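(* Let $f(z)=\sum_{k=0}^n a_k z^k\in\mathbb{C}[z]$ be a polynomial of degree $n\ge 1$ with $f(0)=a_0\neq 0$. Then $$\mathcal{D}[f]\le \sqrt{2}\,\sqrt{\mathcal{H}[f]}.$$ Moreover the inequality is sharp: for every constant $c<\sqrt{2}$ there is a polynomial $f\in\mathbb{C}[z]$ with $f(0)\ne 0$ such that $\mathcal{D}[f]> c\sqrt{\mathcal{H}[f]}$.
   Context: Write the roots of $f$ (with multiplicity) as $r_je^{2\pi i\theta_j}$, $1\le j\le n$, with $r_j>0$ and $\theta_j\in\mathbb{T}=\mathbb{R}/\mathbb{Z}$. For $\alpha\le\beta<\alpha+1$, $N_f(\alpha,\beta)$ denotes the number of $j$ with $\theta_j$ lying in the arc $[\alpha,\beta]$ of $\mathbb{T}$. The discrepancy is $\mathcal{D}[f]=\max_{\alpha\le\beta<\alpha+1}\big(\frac{N_f(\alpha,\beta)}{n}-(\beta-\alpha)\big)$ and the height is $\mathcal{H}[f]=\frac1n\log\frac{\max_{|z|=1}|f(z)|}{\sqrt{|a_0a_n|}}$. *)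

(* Defs.v *)
From HB Require Import structures.
From mathcomp Require Import all_boot all_order all_algebra.
From mathcomp Require Import boolp classical_sets reals exp trigo.
From mathcomp Require Import complex.
Set Implicit Arguments. Unset Strict Implicit. Unset Printing Implicit Defensive.
Import Order.TTheory GRing.Theory Num.Theory.
Local Open Scope ring_scope.
Local Open Scope classical_set_scope.

Section Defs.
Variable R : realType.

Definition cabs (z : R[i]) : R := Num.sqrt (complex.Re z ^+ 2 + complex.Im z ^+ 2).

Definition e2pi (t : R) : R[i] := Complex (cos (2 * pi * t)) (sin (2 * pi * t)).

(* The roots of f, listed with multiplicity:
   f = lead_coef f * prod_(z <- roots) (X - z). *)
Definition polyroots (f : {poly R[i]}) : seq R[i] :=
  projT1 (closed_field_poly_normal f).

Definition arg_in_arc (alpha beta : R) (z : R[i]) : Prop :=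
  exists t : R, alpha <= t <= beta /\ z = ((cabs z)%:C)%C * e2pi t.

Definition Nroots (f : {poly R[i]}) (alpha beta : R) : nat :=
  count (fun z => `[< arg_in_arc alpha beta z >]) (polyroots f).

Definition pdeg (f : {poly R[i]}) : nat := (size f).-1.

Definition discrepancy (f : {poly R[i]}) : R :=
  sup [set x : R | exists alpha beta : R,
         [/\ alpha <= beta, beta < alpha + 1 &
             x = (Nroots f alpha beta)%:R / (pdeg f)%:R - (beta - alpha)]].

Definition supnorm_circle (f : {poly R[i]}) : R :=
  sup [set x : R | exists z : R[i], cabs z = 1 /\ x = cabs f.[z]].

Definition height (f : {poly R[i]}) : R :=
  (pdeg f)%:R^-1 *
  ln (supnorm_circle f / Num.sqrt (cabs (f`_0 * lead_coef f))).

End Defs.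

(* Main.v *)
(* Upper bound.  By Schur's trick the roots may be moved radially to the unit circle;
   write e_j for them, u(x) = (1/n) sum_j log|e(x) - e_j| <= H, and mu for their normalized
   counting measure.  For every t > 0 let psi be the equilibrium measure of the arc
   complementary to a gap around 0 whose Green function G has peak t; up to an additive
   constant G is the logarithmic potential of psi, with mean -log of the capacity, namely
   log cosh t <= t^2/2.  If P_rho is the Poisson semigroup, G - P_rho G is at most
   log(1/rho)/2 because log|1 - r e| - log|1 - r rho e| is.  Positivity of P_rho makes this
   one-sided bound pass to Phi(x) = max_s G(x - s), s running over the roots in the arc I.
   Hence a dual measure with potential Phi is positive, and testing u <= H against it gives
   t mu(I) <= int Phi dmu <= int Phi + H <= t |I| + t^2/2 + H; take t = mu(I) - |I|.
   To stay with finite sums, the circle is replaced by a grid of 2N+1 points with the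
   discrete Poisson kernel, logarithms by their Fourier series truncated at N, and psi by
   the roots of a Chebyshev polynomial composed with a Joukowski map.

   Sharpness.  Among polynomials (1 - z)^k g(z) of degree n = m + k with constant
   coefficient 1, the least l^2 norm is attained at a hypergeometric (reversed Szego)
   polynomial; its square is m! (m + 2k)! / ((m + k)!)^2 <= exp(k^2/m).  It has an atom of
   relative mass k/n at 1, so letting n/k be large and fixed, and then n large, the ratio
   tends to sqrt 2. *)
Require Import Defs.
From HB Require Import structures.
From mathcomp Require Import all_boot all_order all_algebra.
From mathcomp Require Import ring lra zify.
From mathcomp Require Import boolp classical_sets functions reals topology normedtype.
From mathcomp Require Import sequences derive realfun exp trigo.
From mathcomp Require Import complex.
Import Order.TTheory GRing.Theory Num.Theory numFieldNormedType.Exports.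
Local Open Scope ring_scope.

(** * The discrete Poisson kernel *)

Section Grid.
Context {R : realType}.
Implicit Types (x y r rho : R) (N M k m : nat).

Lemma cosD2pin y k : cos (y + 2 * pi * k%:R) = cos y.
Proof.
have -> : y + 2 * pi * k%:R = y + (pi *+ 2) *+ k by rewrite -[in RHS]mulr_natr -(mulr_natr pi); ring.
exact/periodicn/cosD2pi.
Qed.

Lemma sinD2pin y k : sin (y + 2 * pi * k%:R) = sin y.
Proof.
have -> : y + 2 * pi * k%:R = y + (pi *+ 2) *+ k by rewrite -[in RHS]mulr_natr -(mulr_natr pi); ring.
exact/periodicn/sinD2pi.
Qed.

Definition grid M m : R := 2 * pi * m%:R / M%:R.

(** Multiplying by [2 sin(h/2)], with [h = 2 pi k / M], makes the sum telescope over whole turns;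
    [0 < k < M] puts [h/2] strictly inside [(0, pi)], so the factor is nonzero. *)
Lemma sum_cos_grid M k y : (0 < k < M)%N ->
  \sum_(m < M) cos (k%:R * grid M m + y) = 0.
Proof.
move=> /andP[k0 kM].
have M0 : M%:R != 0 :> R by rewrite pnatr_eq0; lia.
pose h : R := 2 * pi * k%:R / M%:R.
have sh : sin (h / 2) != 0.
  rewrite gt_eqF //; apply: sin_gt0_pi; rewrite /h; apply/andP; split.
    by rewrite !(divr_gt0, mulr_gt0) ?pi_gt0 ?ltr0n //; lia.
  rewrite -subr_gt0.
  have -> : pi - 2 * pi * k%:R / M%:R / 2 = pi * (M%:R - k%:R) / M%:R :> R by field.
  by rewrite divr_gt0 ?mulr_gt0 ?pi_gt0 ?ltr0n ?subr_gt0 ?ltr_nat //; lia.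
apply: (mulfI (x := 2 * sin (h / 2))); first by rewrite mulf_neq0 ?pnatr_eq0.
rewrite mulr0 mulr_sumr.
pose s j := sin (j%:R * h - h / 2 + y).
rewrite (eq_bigr (fun m : 'I_M => s m.+1 - s m)); last first.
  move=> m _; rewrite /s -[m.+1%:R]natr1.
  have -> : (m%:R + 1) * h - h / 2 + y = (m%:R * h + y) + h / 2 by field.
  have -> : m%:R * h - h / 2 + y = (m%:R * h + y) - h / 2 by field.
  have -> : k%:R * grid M m + y = m%:R * h + y by rewrite /grid /h; field.
  rewrite sinD sinB; ring.
rewrite -(big_mkord xpredT (fun m => s m.+1 - s m)) telescope_sumr // /s mul0r.
have -> : M%:R * h - h / 2 + y = 0 - h / 2 + y + 2 * pi * k%:R by rewrite /h; field.
by rewrite sinD2pin subrr.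
Qed.

(** Fourier series of the Poisson kernel [(1 - rho^2) / |1 - rho exp(iy)|^2], cut at frequency
    [N]. *)
Definition pois N rho y : R :=
  1 + 2 * \sum_(k < N) rho ^+ k.+1 * cos (k.+1%:R * y).

(** Fourier series of [log |1 - r exp(iy)|], cut at frequency [N]. *)
Definition tlog N r y : R := - \sum_(k < N) r ^+ k.+1 / k.+1%:R * cos (k.+1%:R * y).

Lemma poisN N rho y : pois N rho (- y) = pois N rho y.
Proof.
by rewrite /pois; congr (1 + 2 * _); apply: eq_bigr => k _; rewrite mulrN cosN.
Qed.

Lemma cosMcos (a b : R) : cos a * cos b = (cos (a + b) + cos (a - b)) / 2.
Proof. by rewrite cosD cosB; field. Qed.

Lemma sum_grid_const M (a : R) : \sum_(m < M) a = M%:R * a.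
Proof. by rewrite sumr_const card_ord mulr_natl. Qed.

Lemma sum_tlog_grid N r y :
  \sum_(m < N.*2.+1) tlog N r (grid N.*2.+1 m - y) = 0.
Proof.
rewrite sumrN exchange_big /= big1 ?oppr0 // => k _.
rewrite -mulr_sumr.
under eq_bigr do rewrite mulrBr.
by rewrite sum_cos_grid ?mulr0 //; have := ltn_ord k; lia.
Qed.

Lemma sum_pois_grid N rho y : \sum_(m < N.*2.+1) pois N rho (y - grid N.*2.+1 m) = N.*2.+1%:R.
Proof.
under eq_bigr do rewrite -poisN opprB.
rewrite big_split /= sum_grid_const mulr1 -mulr_sumr exchange_big /= big1 ?mulr0 ?addr0 // => k _.
rewrite -mulr_sumr.
under eq_bigr do rewrite mulrBr.
by rewrite sum_cos_grid ?mulr0 //; have := ltn_ord k; lia.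
Qed.

(* The grid has more than [2 N] points, so no frequency up to [N] is aliased. *)
Lemma sum_cos_cos_grid N x y j k : (0 < j <= N)%N -> (0 < k <= N)%N ->
  \sum_(m < N.*2.+1) cos (j%:R * (x - grid N.*2.+1 m)) * cos (k%:R * (grid N.*2.+1 m - y))
  = if j == k then N.*2.+1%:R * cos (k%:R * (x - y)) / 2 else 0.
Proof.
move=> /andP[j0 jN] /andP[k0 kN]; set M := N.*2.+1.
under eq_bigr do rewrite cosMcos.
rewrite -mulr_suml big_split /=.
rewrite [X in _ + X](eq_bigr (fun m : 'I_M =>
    cos ((j + k)%:R * grid M m + (- j%:R * x - k%:R * y)))); last first.
  by move=> m _; rewrite -cosN; congr cos; rewrite natrD; ring.
rewrite sum_cos_grid ?addr0; last by rewrite /M; lia.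
case: eqP => [->|/eqP jk].
  congr (_ / 2); rewrite -sum_grid_const; apply: eq_bigr => m _; congr cos; ring.
case: (ltnP j k) => ltjk.
  rewrite (eq_bigr (fun m : 'I_M =>
    cos ((k - j)%:R * grid M m + (j%:R * x - k%:R * y)))); last first.
    by move=> m _; congr cos; rewrite natrB 1?ltnW //; ring.
  by rewrite sum_cos_grid ?mul0r //; rewrite /M; lia.
rewrite (eq_bigr (fun m : 'I_M =>
    cos ((j - k)%:R * grid M m + (- j%:R * x + k%:R * y)))); last first.
  by move=> m _; rewrite -cosN; congr cos; rewrite natrB //; ring.
by rewrite sum_cos_grid ?mul0r //; rewrite /M; lia.
Qed.

(** Discrete convolution with [pois] is diagonal in the cosines: frequency [k] meets only the
    matching term of the kernel and is multiplied by [rho^k]. *)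
Lemma sum_pois_cos N rho x y k : (0 < k <= N)%N ->
  \sum_(m < N.*2.+1) pois N rho (x - grid N.*2.+1 m) * cos (k%:R * (grid N.*2.+1 m - y))
  = N.*2.+1%:R * (rho ^+ k * cos (k%:R * (x - y))).
Proof.
move=> k0N; have /andP[k0 kN] := k0N; set M := N.*2.+1.
under eq_bigr do rewrite mulrDl mul1r.
rewrite big_split /=.
rewrite (_ : \sum_(i < M) cos (k%:R * (grid M i - y)) = 0); last first.
  under eq_bigr do rewrite mulrBr.
  by rewrite sum_cos_grid //; rewrite /M; lia.
rewrite add0r.
under eq_bigr do rewrite -mulrA mulr_suml.
rewrite -mulr_sumr exchange_big /=.
case: k k0 kN k0N => // k _ kN k0N.
rewrite (bigD1 (Ordinal kN)) //= [X in _ + X]big1 ?addr0.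
  under eq_bigr do rewrite -mulrA.
  by rewrite -mulr_sumr sum_cos_cos_grid ?eqxx ?kN // -/M; field.
move=> j jk.
under eq_bigr do rewrite -mulrA.
rewrite -mulr_sumr sum_cos_cos_grid ?ltn_ord //.
rewrite ifF ?mulr0 //; apply/negP => /eqP [jk']; move: jk.
by rewrite -(inj_eq val_inj) /= jk' eqxx.
Qed.

(** Only frequency [1] pairs with the cosine. This moment later measures how strongly a kernel built
    from [tlog] concentrates at the origin. *)
Lemma sum_tlog_cos N r y : (0 < N)%N ->
  \sum_(m < N.*2.+1) tlog N r (grid N.*2.+1 m - y) * cos (grid N.*2.+1 m - y) =
  - (N.*2.+1%:R * r / 2).
Proof.
case: N => // N _.
rewrite /tlog; under eq_bigr do rewrite mulNr mulr_suml.
rewrite sumrN exchange_big /=; congr (- _).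
have sumE (k : 'I_N.+1) : \sum_(m < N.+1.*2.+1) r ^+ k.+1 / k.+1%:R *
      cos (k.+1%:R * (grid N.+1.*2.+1 m - y)) * cos (grid N.+1.*2.+1 m - y) =
    r ^+ k.+1 / k.+1%:R * (if k.+1 == 1%N then N.+1.*2.+1%:R / 2 else 0).
  transitivity (r ^+ k.+1 / k.+1%:R * \sum_(m < N.+1.*2.+1)
     cos (k.+1%:R * (y - grid N.+1.*2.+1 m)) * cos (1%:R * (grid N.+1.*2.+1 m - y))).
    rewrite mulr_sumr; apply: eq_bigr => m _.
    by rewrite -mulrA -[in RHS](cosN (k.+1%:R * _)) -mulrN opprB mul1r.
  by rewrite sum_cos_cos_grid ?ltn_ord //= subrr mulr0 cos0 mulr1.
transitivity (\sum_(k < N.+1) r ^+ k.+1 / k.+1%:R *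
    (if k.+1 == 1%N then N.+1.*2.+1%:R / 2 else 0)).
  by apply: eq_bigr => k _; exact: sumE.
rewrite (bigD1 ord0) //= big1 ?addr0.
  by rewrite expr1 divr1; ring.
move=> k k0; rewrite ifF ?mulr0 //.
by apply/negP; rewrite eqSS => /eqP k0'; move: k0; rewrite -(inj_eq val_inj) /= k0' eqxx.
Qed.

(** Semigroup property: damping frequency [k] by [rho^k] amounts to replacing the radius [r] by
    [r rho]. *)
Lemma sum_pois_tlog N rho r x y :
  \sum_(m < N.*2.+1) pois N rho (x - grid N.*2.+1 m) * tlog N r (grid N.*2.+1 m - y)
  = N.*2.+1%:R * tlog N (r * rho) (x - y).
Proof.
rewrite /tlog.
under eq_bigr do rewrite mulrN mulr_sumr.
rewrite sumrN exchange_big /= mulrN; congr (- _); rewrite mulr_sumr.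
apply: eq_bigr => k _.
under eq_bigr do rewrite mulrCA.
rewrite -mulr_sumr sum_pois_cos ?ltn_ord // exprMn.
ring.
Qed.

Lemma poisE N rho y :
  pois N rho y * (1 - 2 * rho * cos y + rho ^+ 2) =
  1 - rho ^+ 2 - 2 * rho ^+ N.+1 * (cos (N.+1%:R * y) - rho * cos (N%:R * y)).
Proof.
elim: N => [|N IH].
  by rewrite /pois big_ord0 mulr0 addr0 mul0r cos0 !mul1r; ring.
have -> : pois N.+1 rho y = pois N rho y + 2 * (rho ^+ N.+1 * cos (N.+1%:R * y)).
  by rewrite /pois big_ord_recr /=; ring.
rewrite mulrDl {}IH.
have -> : (N.+2%:R : R) * y = N.+1%:R * y + y by rewrite -[N.+2%:R]natr1; ring.
have -> : (N%:R : R) * y = N.+1%:R * y - y by rewrite -[N.+1%:R]natr1; ring.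
rewrite cosB cosD [rho ^+ N.+2]exprS [rho ^+ N.+1]exprS; ring.
Qed.

(** The truncated kernel can be negative off the grid. At a difference [z] of grid points
    [(N+1) z + N z] is a multiple of [2 pi], so the two cosines in [poisE] agree and its right side
    factors as [(1 - rho) (1 + rho - 2 rho^(N+1) cos(N z))]. *)
Lemma pois_grid_ge0 N rho (i j : nat) : 0 <= rho < 1 ->
  0 <= pois N rho (grid N.*2.+1 i - grid N.*2.+1 j).
Proof.
wlog ij : i j / (j <= i)%N.
  move=> W rho01; case: (leqP j i) => ij; first exact: W.
  by rewrite -poisN opprB W // ltnW.
move=> /andP[r0 r1].
set y := _ - _.
have M0 : N.*2.+1%:R != 0 :> R by rewrite pnatr_eq0.
have -> : y = 2 * pi * (i - j)%:R / N.*2.+1%:R.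
  by rewrite /y /grid natrB //; move: (N.*2.+1) M0 => M M0; field.
set m := (i - j)%N; set z := 2 * pi * _ / _.
have cos1 : cos (N.+1%:R * z) = cos (N%:R * z).
  have -> : N.+1%:R * z = - (N%:R * z) + 2 * pi * m%:R.
    have -> : 2 * pi * m%:R = N.*2.+1%:R * z.
      by rewrite /z; move: (N.*2.+1) M0 => M M0; field.
    by rewrite -[N.*2.+1%:R]natr1 -[N.+1%:R]natr1 -muln2 natrM; ring.
  by rewrite cosD2pin cosN.
have := poisE N rho z; rewrite cos1.
have -> : 1 - rho ^+ 2 - 2 * rho ^+ N.+1 * (cos (N%:R * z) - rho * cos (N%:R * z))
   = (1 - rho) * (1 + rho - 2 * rho ^+ N.+1 * cos (N%:R * z)) by ring.
have d0 : 0 < 1 - 2 * rho * cos z + rho ^+ 2.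
  have : 2 * rho * cos z <= 2 * rho by rewrite ler_piMr ?cos_le1 // mulr_ge0.
  have : 0 < (1 - rho) ^+ 2 by rewrite exprn_gt0 ?subr_gt0.
  nra.
move=> E; rewrite -(pmulr_lge0 _ d0) E mulr_ge0 ?subr_ge0 1?ltW //.
have rN : rho ^+ N.+1 <= rho.
  by rewrite exprS ler_piMr // exprn_ile1 // ltW.
have r0N : 0 <= rho ^+ N.+1 by rewrite exprn_ge0.
have : rho ^+ N.+1 * cos (N%:R * z) <= rho ^+ N.+1 by rewrite ler_piMr ?cos_le1.
lra.
Qed.

End Grid.

(** * The logarithmic kernel *)

Section LogKernel.
Context {R : realType}.
Implicit Types (x y r rho : R) (N k : nat).

Definition logker r y : R := ln (1 - 2 * r * cos y + r ^+ 2) / 2.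

Lemma logker_arg_ge r y : 0 <= r -> (1 - r) ^+ 2 <= 1 - 2 * r * cos y + r ^+ 2.
Proof.
move=> r0; have : r * cos y <= r by rewrite ler_piMr ?cos_le1.
nra.
Qed.

Lemma logker_arg_gt0 r y : 0 <= r < 1 -> 0 < 1 - 2 * r * cos y + r ^+ 2.
Proof.
move=> /andP[r0 r1]; apply: (lt_le_trans _ (logker_arg_ge r y r0)).
by rewrite exprn_gt0 // subr_gt0.
Qed.

Lemma sum_geo_cos N r y :
  (\sum_(k < N) r ^+ k * cos (k.+1%:R * y)) * (1 - 2 * r * cos y + r ^+ 2) =
  cos y - r - r ^+ N * (cos (N.+1%:R * y) - r * cos (N%:R * y)).
Proof.
elim: N => [|N IH]; first by rewrite big_ord0 !mul0r cos0 !mul1r; ring.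
rewrite big_ord_recr /= mulrDl {}IH.
have -> : (N.+2%:R : R) * y = N.+1%:R * y + y by rewrite -[N.+2%:R]natr1; ring.
have -> : (N%:R : R) * y = N.+1%:R * y - y by rewrite -[N.+1%:R]natr1; ring.
rewrite cosB cosD [r ^+ N.+1]exprS; ring.
Qed.

Lemma is_derive_tlog N y r : is_derive r 1 (fun r => tlog N r y)
  (- \sum_(k < N) r ^+ k * cos (k.+1%:R * y)).
Proof.
have -> : (fun r => tlog N r y) =
    - (\sum_(k < N) ((cos (k.+1%:R * y) / k.+1%:R) *: ((id : R -> R) ^+ k.+1) : R -> R)).
  apply/funext => s; rewrite /tlog fctE; congr (- _).
  rewrite fct_sumE; apply: eq_bigr => k _.
  rewrite !fctE /GRing.scale /=. ring.
apply: is_derive_eq; congr (- _); apply: eq_bigr => k _.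
rewrite /GRing.scale /=. field.
by rewrite nat1r pnatr_eq0.
Qed.

Lemma is_derive_logker y r : 0 < 1 - 2 * r * cos y + r ^+ 2 ->
  is_derive r 1 (fun r => logker r y) ((r - cos y) / (1 - 2 * r * cos y + r ^+ 2)).
Proof.
move=> h.
have d1 : is_derive r 1 (fun r => 1 - 2 * r * cos y + r ^+ 2) (2 * (r - cos y)).
  pose p : {poly R} := 1%:P - (2 * cos y) *: 'X + 'X^2.
  have -> : (fun r => 1 - 2 * r * cos y + r ^+ 2) = horner p.
    by apply/funext => s; rewrite !hornerE; ring.
  have -> : 2 * (r - cos y) = p^`().[r].
    rewrite /p derivD derivB derivZ derivX derivXn derivC !hornerE /=; ring.
  exact: is_derive_poly.
have d2 := is_derive1_ln h.
have -> : (fun r => logker r y) = 2^-1 *: (@ln R \o (fun r => 1 - 2 * r * cos y + r ^+ 2)).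
  by apply/funext => s; rewrite /logker /= mulrC.
apply: is_derive_eq.
by rewrite /GRing.scale /=; field; rewrite gt_eqF.
Qed.
End LogKernel.

(** * Truncation error and radial comparison of the logarithmic kernel *)

Section LogApprox.
Context {R : realType}.
Implicit Types (x y r rho : R) (N k : nat).

Lemma tlog0 N y : tlog N 0 y = 0 :> R.
Proof. by rewrite /tlog big1 ?oppr0 // => k _; rewrite expr0n /= !mul0r. Qed.

Lemma logker0 y : logker 0 y = 0 :> R.
Proof. by rewrite /logker mulr0 mul0r expr0n /= subr0 addr0 ln1 mul0r. Qed.

(** Both functions vanish at radius [0], so the mean value theorem applies in the radius. By
    [sum_geo_cos] the two derivatives differ only by a remainder of order [s^N] at radius [s]. *)
Lemma tlog_logker_dist N r y : 0 <= r < 1 ->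
  `|tlog N r y - logker r y| <= 2 * r ^+ N / (1 - r) ^+ 2.
Proof.
move=> /andP[r0 r1].
pose D s := 1 - 2 * s * cos y + s ^+ 2.
pose dg s := - \sum_(k < N) s ^+ k * cos (k.+1%:R * y) - (s - cos y) / D s.
have Dgt0 (s : R) : 0 <= s < 1 -> 0 < D s by apply: logker_arg_gt0.
have dgE (s : R) : 0 <= s < 1 -> is_derive s 1 (fun s => tlog N s y - logker s y) (dg s).
  move=> s01.
  have h1 := is_derive_tlog N y s.
  have h2 := is_derive_logker y s (Dgt0 _ s01).
  exact: is_deriveB h1 h2.
have cont : {within `[0, r], continuous (fun s : R => tlog N s y - logker s y)}%classic.
  apply: derivable_within_continuous => s; rewrite in_itv /= => /andP[s0 sr].
  by apply: (@ex_derive _ _ _ _ _ _ _ (dgE s _)); rewrite s0 (le_lt_trans sr).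
have dgE' (s : R) : s \in `]0, r[ -> is_derive s 1 (fun s => tlog N s y - logker s y) (dg s).
  by rewrite in_itv /= => /andP[s0 sr]; apply: dgE; rewrite ltW // (lt_trans sr).
have [s] := MVT_segment r0 dgE' cont.
rewrite in_itv /= => /andP[s0 sr].
rewrite tlog0 logker0 !subr0 => ->.
have s1 : s < 1 by rewrite (le_lt_trans sr).
have D0 : 0 < D s by apply: Dgt0; rewrite s0.
have -> : dg s = s ^+ N * (cos (N.+1%:R * y) - s * cos (N%:R * y)) / D s.
  have Dn0 : D s != 0 by rewrite gt_eqF.
  apply: (mulIf Dn0); rewrite /dg.
  rewrite mulrBl !divfK ?gt_eqF // mulNr sum_geo_cos; ring.
rewrite normrM (ger0_norm r0) normrM normfV (gtr0_norm D0) normrM normrX (ger0_norm s0).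
have c2 : `|cos (N.+1%:R * y) - s * cos (N%:R * y)| <= 2.
  apply: (le_trans (ler_normB _ _)); rewrite normrM (ger0_norm s0).
  have := cos_max (N.+1%:R * y); have := cos_max (N%:R * y).
  have := normr_ge0 (cos (N%:R * y)); nra.
have sN : s ^+ N <= r ^+ N by rewrite lerXn2r.
have D1 : (1 - r) ^+ 2 <= D s.
  apply: le_trans (logker_arg_ge s y s0); rewrite lerXn2r ?nnegrE ?subr_ge0 //; lra.
have r2 : 0 < (1 - r) ^+ 2 by rewrite exprn_gt0 ?subr_gt0.
apply: (@le_trans _ _ (s ^+ N * `|cos (N.+1%:R * y) - s * cos (N%:R * y)| / D s)).
  by rewrite ler_piMr ?(ltW r1) // divr_ge0 ?(ltW D0) // mulr_ge0 ?exprn_ge0.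
rewrite ler_pM ?mulr_ge0 ?invr_ge0 ?exprn_ge0 //; first exact: ltW.
  by rewrite (mulrC 2) ler_pM ?exprn_ge0.
by rewrite lef_pV2.
Qed.

Lemma expr_small r (e : R) : 0 <= r < 1 -> 0 < e ->
  exists N0 : nat, forall N, (N0 <= N)%N -> r ^+ N <= e.
Proof.
move=> /andP[r0 r1] e0.
have r1' : `|r| < 1 by rewrite ger0_norm.
have /cvgrPdist_le /(_ e e0) [N0 _ H] := cvg_expr r1'.
exists N0 => N NN; have := H N NN.
by rewrite /= sub0r normrN ger0_norm // exprn_ge0.
Qed.

Lemma tlog_logker_near r (e : R) : 0 <= r < 1 -> 0 < e ->
  exists N0 : nat, forall N, (N0 <= N)%N -> forall y, `|tlog N r y - logker r y| <= e.
Proof.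
move=> r01 e0; have /andP[r0 r1] := r01.
have r2 : 0 < (1 - r) ^+ 2 by rewrite exprn_gt0 ?subr_gt0.
have [|N0 H] := expr_small r (e * (1 - r) ^+ 2 / 2) r01.
  by rewrite divr_gt0 // mulr_gt0.
exists N0 => N /H HN y; apply: (le_trans (tlog_logker_dist _ _ _ r01)).
by rewrite ler_pdivrMr // -ler_pdivlMl // mulrC.
Qed.

(* AM-GM: [|1 - r e|^2 / r = r + 1/r - 2 cos y] decreases in [r < 1]. *)
Lemma logkerB_le r rho y : 0 <= r < 1 -> 0 < rho < 1 ->
  logker r y - logker (r * rho) y <= - ln rho / 2.
Proof.
move=> r01 /andP[p0 p1]; have /andP[r0 r1] := r01.
have rp01 : 0 <= r * rho < 1.
  by rewrite mulr_ge0 ?(ltW p0) //= mulr_ilt1 ?(ltW p0).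
have D1 := logker_arg_gt0 r y r01; have D2 := logker_arg_gt0 _ y rp01.
rewrite /logker -mulrBl ler_pM2r ?invr_gt0 //.
suff : ln (1 - 2 * r * cos y + r ^+ 2) + ln rho
  <= ln (1 - 2 * (r * rho) * cos y + (r * rho) ^+ 2) by lra.
rewrite -lnM ?posrE // ler_ln ?posrE ?mulr_gt0 //.
have : 0 <= (1 - rho) * (1 - r * r * rho).
  rewrite mulr_ge0 ?subr_ge0 ?(ltW p1) //.
  by case/andP: rp01 => a b; rewrite -mulrA mulr_ile1 ?(ltW r1) ?(ltW b).
nra.
Qed.

Lemma sin_natmul_le k x : `|sin (k%:R * x)| <= k%:R * `|sin x|.
Proof.
elim: k => [|k IH]; first by rewrite !mul0r sin0 normr0.
have -> : k.+1%:R * x = k%:R * x + x by rewrite -natr1 mulrDl mul1r.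
rewrite sinD -natr1 mulrDl mul1r (le_trans (ler_normD _ _)) // lerD //.
  by rewrite normrM (le_trans _ IH) // ler_piMr ?cos_max.
by rewrite normrM ler_piMl ?cos_max.
Qed.

(** Via [1 - cos z = 2 sin^2(z/2)] this is the square of the preceding bound. *)
Lemma onesubcos_natmul_le k y : 1 - cos (k%:R * y) <= k%:R ^+ 2 * (1 - cos y).
Proof.
have half z : 1 - cos z = 2 * `|sin (z / 2)| ^+ 2.
  rewrite real_normK ?num_real //.
  have {1}-> : z = (z / 2) *+ 2 by rewrite -mulr_natr divfK ?pnatr_eq0.
  by rewrite cos_mulr2n cos2sin2; ring.
rewrite !half [leRHS]mulrCA ler_pM2l // -exprMn lerXn2r ?nnegrE ?mulr_ge0 //.
by rewrite -mulrA sin_natmul_le.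
Qed.

Lemma sum_geo_deriv_le N r : 0 <= r < 1 ->
  \sum_(k < N) k.+1%:R * r ^+ k <= ((1 - r) ^+ 2)^-1.
Proof.
move=> /andP[r0 r1].
have r2 : 0 < (1 - r) ^+ 2 by rewrite exprn_gt0 ?subr_gt0.
rewrite -[leRHS]mul1r ler_pdivlMr //.
have -> : (\sum_(k < N) k.+1%:R * r ^+ k) * (1 - r) ^+ 2 =
   1 - r ^+ N * (N.+1%:R - N%:R * r).
  elim: N => [|N IH]; first by rewrite big_ord0; ring.
  rewrite big_ord_recr /= mulrDl IH [r ^+ N.+1]exprS -[N.+2%:R]natr1 -[N.+1%:R]natr1; ring.
rewrite gerBl mulr_ge0 ?exprn_ge0 // -natr1.
have : N%:R * r <= N%:R by rewrite ler_piMr // ltW.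
lra.
Qed.

End LogApprox.

(** * Duality on the grid *)

Section Duality.
Context {R : realType}.
Implicit Types (x y r rho : R) (N k : nat).

(** The weights [d - (F - tau F)] are nonnegative with total mass [M d]; [u <= H] is tested against
    them. Symmetry moves [tau] from [F] to [u], and [sum u = 0] removes the constant [d]. *)
Lemma duality_finite M (tau : 'I_M -> 'I_M -> R) (F u : 'I_M -> R) (d H : R) :
  (forall i j, tau i j = tau j i) -> (forall i, \sum_j tau i j = 1) ->
  (forall i, F i - \sum_j tau i j * F j <= d) -> (forall i, u i <= H) ->
  \sum_i u i = 0 ->
  \sum_i F i * (\sum_j tau i j * u j - u i) <= M%:R * d * H.
Proof.
move=> tauC tau1 Fd uH u0.
have tau1' j : \sum_i tau i j = 1 by under eq_bigr do rewrite tauC; exact: tau1.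
have swap : \sum_i F i * \sum_j tau i j * u j = \sum_i (\sum_j tau i j * F j) * u i.
  under eq_bigr do rewrite mulr_sumr.
  rewrite exchange_big /=; apply: eq_bigr => j _; rewrite mulr_suml.
  by apply: eq_bigr => i _; rewrite tauC; ring.
have le1 : \sum_i (d - (F i - \sum_j tau i j * F j)) * u i <=
           \sum_i (d - (F i - \sum_j tau i j * F j)) * H.
  by apply: ler_sum => i _; rewrite ler_wpM2l ?subr_ge0.
have eq1 : \sum_i (d - (F i - \sum_j tau i j * F j)) * u i =
    \sum_i F i * (\sum_j tau i j * u j - u i).
  under [RHS]eq_bigr do rewrite mulrBr.
  rewrite sumrB swap -sumrB.
  have -> : \sum_i (d - (F i - \sum_j tau i j * F j)) * u i =
     d * \sum_i u i + \sum_i ((\sum_j tau i j * F j) * u i - F i * u i).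
    by rewrite mulr_sumr -big_split /=; apply: eq_bigr => i _; ring.
  by rewrite u0 mulr0 add0r.
have eq2 : \sum_i (d - (F i - \sum_j tau i j * F j)) = M%:R * d.
  rewrite sumrB sum_grid_const sumrB.
  suff -> : \sum_i \sum_j tau i j * F j = \sum_i F i by rewrite subrr subr0.
  by rewrite exchange_big /=; apply: eq_bigr => j _; rewrite -mulr_suml tau1' mul1r.
by move: le1; rewrite eq1 -mulr_suml eq2.
Qed.

(** Truncated potential, at radius [r], of the probability measure with mass [1/(2q)] at each of
    [nu i] and [- nu i]. *)
Definition avglog q (nu : 'I_q -> R) N r y : R :=
  (\sum_(i < q) (tlog N r (y - nu i) + tlog N r (y + nu i))) / (2 * q%:R).

Lemma sum_avglog_grid q nu N r y :
  \sum_(m < N.*2.+1) @avglog q nu N r (grid N.*2.+1 m - y) = 0.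
Proof.
rewrite -mulr_suml exchange_big big1 ?mul0r // => i _.
rewrite big_split /=.
under eq_bigr do rewrite -addrA -opprD.
under [X in _ + X]eq_bigr do rewrite -addrA -(opprK (nu i)) -opprD.
by rewrite !sum_tlog_grid addr0.
Qed.

Lemma sum_pois_avglog q nu N rho r x y :
  \sum_(m < N.*2.+1) pois N rho (x - grid N.*2.+1 m) * @avglog q nu N r (grid N.*2.+1 m - y)
  = N.*2.+1%:R * avglog q nu N (r * rho) (x - y).
Proof.
rewrite /avglog; under eq_bigr do rewrite mulrA.
rewrite -mulr_suml mulrA; congr (_ / _).
under eq_bigr do rewrite mulr_sumr.
rewrite exchange_big mulr_sumr; apply: eq_bigr => i _ /=.
under eq_bigr do rewrite mulrDr.
rewrite big_split /=.
under eq_bigr do rewrite -[X in tlog _ _ X]addrA -opprD.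
under [X in _ + X]eq_bigr do rewrite -[X in tlog _ _ X]addrA -(opprK (nu i)) -opprD.
by rewrite !sum_pois_tlog mulrDr !opprD !opprK !addrA.
Qed.

Lemma avglogB_le q nu N r rho (d : R) y : (0 < q)%N ->
  (forall y, tlog N r y - tlog N (r * rho) y <= d) ->
  @avglog q nu N r y - avglog q nu N (r * rho) y <= d.
Proof.
move=> q0 H; rewrite /avglog -mulrBl -sumrB.
rewrite ler_pdivrMr ?mulr_gt0 ?ltr0n //.
have -> : d * (2 * q%:R) = \sum_(i < q) 2 * d by rewrite sumr_const card_ord -mulr_natr; ring.
apply: ler_sum => i _.
have := H (y - nu i); have := H (y + nu i); lra.
Qed.

(** The symmetry of the measure cancels the sine terms. What remains at frequency [k] is controlled
    by [1 - cos(k y) <= k^2 (1 - cos y)], and [sum k r^(k-1)] by [(1 - r)^(-2)]. Thus a kernel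
    concentrated at [0] nearly reads off the value of the potential there. *)
Lemma avglog0B_le q nu N r y : (0 < q)%N -> 0 <= r < 1 ->
  @avglog q nu N r 0 - avglog q nu N r y <= ((1 - r) ^+ 2)^-1 * (1 - cos y).
Proof.
move=> q0 r01; have /andP[r0 r1] := r01.
rewrite /avglog -mulrBl -sumrB ler_pdivrMr ?mulr_gt0 ?ltr0n //.
set C := _^-1.
have -> : C * (1 - cos y) * (2 * q%:R) = \sum_(i < q) (2 * C * (1 - cos y)).
  by rewrite sumr_const card_ord -mulr_natr; ring.
apply: ler_sum => i _.
have -> : tlog N r (0 - nu i) + tlog N r (0 + nu i) - (tlog N r (y - nu i) + tlog N r (y + nu i))
  = \sum_(k < N) - (2 * (r ^+ k.+1 / k.+1%:R) * cos (k.+1%:R * nu i) * (1 - cos (k.+1%:R * y))).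
  rewrite /tlog -!sumrN -!big_split -sumrN -big_split; apply: eq_bigr => k _ /=.
  rewrite !sub0r !add0r !mulrN !cosN mulrBr mulrDr cosB cosD; ring.
apply: (@le_trans _ _ (2 * (\sum_(k < N) k.+1%:R * r ^+ k) * (1 - cos y))); last first.
  by rewrite ler_wpM2r ?subr_ge0 ?cos_le1 // ler_pM2l // sum_geo_deriv_le.
rewrite mulr_sumr mulr_suml; apply: ler_sum => k _.
have h1 := onesubcos_natmul_le k.+1 y.
have h2 := cos_geN1 (k.+1%:R * nu i).
have h3 := cos_le1 (k.+1%:R * y).
have rk : 0 <= r ^+ k by rewrite exprn_ge0.
have rk' : r ^+ k.+1 <= r ^+ k by rewrite exprS ler_piMl // ltW.
set a := 2 * (r ^+ k.+1 / k.+1%:R).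
have a0 : 0 <= a by rewrite /a mulr_ge0 // divr_ge0 ?exprn_ge0.
apply: (@le_trans _ _ (a * (1 - cos (k.+1%:R * y)))).
  rewrite -subr_ge0 opprK.
  have -> : a * (1 - cos (k.+1%:R * y)) + a * cos (k.+1%:R * nu i) * (1 - cos (k.+1%:R * y))
    = a * (1 - cos (k.+1%:R * y)) * (1 + cos (k.+1%:R * nu i)) by ring.
  by apply: mulr_ge0; [apply: mulr_ge0 => //; rewrite subr_ge0 | rewrite -lerBlDl sub0r].
apply: (@le_trans _ _ (a * (k.+1%:R ^+ 2 * (1 - cos y)))).
  by rewrite ler_wpM2l.
rewrite [leLHS]mulrA; apply: ler_wpM2r; first by rewrite subr_ge0 cos_le1.
have -> : a * k.+1%:R ^+ 2 = 2 * (k.+1%:R * r ^+ k.+1).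
  by rewrite /a; field; rewrite nat1r pnatr_eq0.
by rewrite ler_pM2l // ler_wpM2l.
Qed.

(* Positivity of the discrete Poisson operator [T] lets the bound [f - T f <= d], valid
   for each translate, pass to the maximum of the translates. *)
Lemma duality_max_translates q (nu : 'I_q -> R) N n (th : 'I_n -> R) (J : pred 'I_n)
    r rho (d H m1 : R) :
  (0 < q)%N -> (0 < N)%N -> 0 <= r < 1 -> 0 <= rho < 1 -> 0 <= d ->
  (forall y, tlog N r y - tlog N (r * rho) y <= d) ->
  (forall y, tlog N rho y - tlog N (rho * rho) y <= d) ->
  (forall x, \sum_j tlog N rho (x - th j) <= n%:R * H) ->
  (forall y, 0 <= m1 + avglog q nu N r y) ->
  #|J|%:R * (d * (m1 + avglog q nu N r 0) -
     ((1 - r) ^+ 2)^-1 * (d - rho * (1 - rho) / 2)) <=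
  n%:R * (d * H + d * (\sum_(m < N.*2.+1)
     \big[Order.max/0]_(j | J j) (m1 + avglog q nu N r (grid N.*2.+1 m - th j))) / N.*2.+1%:R).
Proof.
move=> q0 N0 r01 rho01 d0 Hr Hrho HH chi0.
set M := N.*2.+1.
have M0 : 0 < M%:R :> R by rewrite ltr0n.
pose chi y := m1 + avglog q nu N r y.
(* The default [0] of the maximum is compatible with [chi >= 0] and covers an empty [J]. *)
pose Psi (m : 'I_M) := \big[Order.max/0]_(j | J j) chi (grid M m - th j).
have Psi0 m : 0 <= Psi m.
  by rewrite /Psi; apply: bigmax_ge_id.
have Psij (m : 'I_M) j : J j -> chi (grid M m - th j) <= Psi m.
  by move=> Jj; apply: (le_bigmax_cond 0 (fun j => chi (grid M m - th j)) Jj).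
pose tau (i j : 'I_M) := pois N rho (grid M i - grid M j) / M%:R.
pose u (m : 'I_M) := \sum_j tlog N rho (grid M m - th j).
have tau0 i j : 0 <= tau i j by rewrite divr_ge0 ?(ltW M0) // pois_grid_ge0.
have tauC i j : tau i j = tau j i by rewrite /tau -poisN opprB.
have tau1 i : \sum_j tau i j = 1 by rewrite -mulr_suml sum_pois_grid divff ?gt_eqF.
have PsiT i : Psi i - \sum_j tau i j * Psi j <= d.
  rewrite lerBlDr; apply: bigmax_le => [|k Jk].
    by rewrite addr_ge0 // sumr_ge0 // => j _; rewrite mulr_ge0.
  apply: (@le_trans _ _ (d + \sum_j tau i j * chi (grid M j - th k))); last first.
    by rewrite lerD2l; apply: ler_sum => j _; rewrite ler_wpM2l // Psij.
  have -> : \sum_j tau i j * chi (grid M j - th k) =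
      m1 + avglog q nu N (r * rho) (grid M i - th k).
    under eq_bigr do rewrite mulrDr.
    rewrite big_split /= -mulr_suml tau1 mul1r; congr (_ + _).
    under eq_bigr do rewrite mulrAC.
    by rewrite -mulr_suml sum_pois_avglog mulrAC divff ?gt_eqF // mul1r.
  have := avglogB_le q nu N r rho d (grid M i - th k) q0 Hr.
  rewrite /chi; lra.
have u0 : \sum_i u i = 0.
  by rewrite exchange_big big1 // => j _; rewrite sum_tlog_grid.
have := duality_finite M tau Psi u d (n%:R * H) tauC tau1 PsiT (fun i => HH _) u0.
(* [tau u - u] is the sum of the translates of [ker - d] to the roots. [ker] is nonnegative with
   grid mean [d] and cosine mean [rho (1 - rho) / 2]; the later choice of parameters makes these
   nearly equal, so that [ker] acts like a point mass. *)
pose ker y := tlog N (rho * rho) y - tlog N rho y + d.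
have ker0 y : 0 <= ker y by rewrite /ker; have := Hrho y; lra.
have -> : \sum_i Psi i * (\sum_j tau i j * u j - u i) =
   \sum_j \sum_(m < M) Psi m * ker (grid M m - th j) - n%:R * d * \sum_m Psi m.
  have Tu i : \sum_j tau i j * u j = \sum_j tlog N (rho * rho) (grid M i - th j).
    rewrite /u; under eq_bigr do rewrite mulr_sumr.
    rewrite exchange_big; apply: eq_bigr => j _ /=.
    under eq_bigr do rewrite mulrAC.
    by rewrite -mulr_suml sum_pois_tlog mulrAC divff ?gt_eqF // mul1r.
  rewrite exchange_big mulr_sumr -sumrB; apply: eq_bigr => m _ /=.
  rewrite Tu /u -mulr_sumr.
  have -> : \sum_j ker (grid M m - th j) = \sum_j tlog N (rho * rho) (grid M m - th j)
      - \sum_j tlog N rho (grid M m - th j) + n%:R * d.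
    by rewrite -sumrB -sum_grid_const -big_split.
  ring.
(* For a root in [J] the maximum dominates the translate centred there, which falls below its
   central value by at most [C (1 - cos)]; the two moments of [ker] finish the estimate. *)
have Jle j : J j -> M%:R * (d * chi 0 - ((1 - r) ^+ 2)^-1 * (d - rho * (1 - rho) / 2))
    <= \sum_(m < M) Psi m * ker (grid M m - th j).
  move=> Jj; set C := _^-1.
  apply: (@le_trans _ _ (\sum_(m < M) (chi 0 - C * (1 - cos (grid M m - th j))) * ker (grid M m - th j))); last first.
    apply: ler_sum => m _; rewrite ler_wpM2r //; apply: le_trans (Psij m j Jj).
    by have := avglog0B_le q nu N r (grid M m - th j) q0 r01; rewrite -/C /chi; lra.
  have sk : \sum_(m < M) ker (grid M m - th j) = M%:R * d.
    by rewrite big_split sumrB /= !sum_tlog_grid subrr add0r sum_grid_const.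
  have skc : \sum_(m < M) ker (grid M m - th j) * cos (grid M m - th j) =
     M%:R * (rho * (1 - rho) / 2).
    under eq_bigr do rewrite mulrDl mulrBl.
    rewrite big_split sumrB /= !sum_tlog_cos // -mulr_sumr.
    have := sum_cos_grid M 1 (- th j); under eq_bigr do rewrite mul1r.
    move=> ->; last by rewrite /M; lia.
    rewrite -/M; clearbody M; by field.
  rewrite (eq_bigr (fun m : 'I_M => (chi 0 - C) * ker (grid M m - th j) +
      C * (ker (grid M m - th j) * cos (grid M m - th j)))); last first.
    by move=> m _; ring.
  rewrite big_split /= -!mulr_sumr sk skc.
  by rewrite le_eqVlt; apply/orP; left; apply/eqP; clearbody M; field.
(* Roots outside [J] contribute nonnegative terms, which are dropped. *)
have : #|J|%:R * (M%:R * (d * chi 0 - ((1 - r) ^+ 2)^-1 * (d - rho * (1 - rho) / 2)))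
   <= \sum_j \sum_(m < M) Psi m * ker (grid M m - th j).
  rewrite (bigID J) /= -[leLHS]addr0 lerD //.
    rewrite mulr_natl -sumr_const; exact: ler_sum.
  by apply: sumr_ge0 => j _; apply: sumr_ge0 => m _; rewrite mulr_ge0.
rewrite /chi => h1 h2.
rewrite -(ler_pM2l M0).
have -> : M%:R * (n%:R * (d * H + d * (\sum_(m < M) Psi m) / M%:R)) =
  M%:R * d * (n%:R * H) + n%:R * d * \sum_m Psi m.
  by field; rewrite gt_eqF.
move: h1 h2; rewrite /chi /=; lra.
Qed.

End Duality.

(** * The Green function of an arc *)

Section ComplexNorm.
Context {R : realType}.
Implicit Types (x y r : R) (z w : R[i]).

Definition nsq z : R := complex.Re z ^+ 2 + complex.Im z ^+ 2.

Lemma nsqM z w : nsq (z * w) = nsq z * nsq w.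
Proof. by case: z => a b; case: w => c d; rewrite /nsq /=; ring. Qed.

Lemma nsq1 : nsq 1 = 1.
Proof. by rewrite /nsq /=; ring. Qed.

Lemma nsqX z n : nsq (z ^+ n) = nsq z ^+ n.
Proof. by elim: n => [|n IH]; rewrite ?nsq1 // !exprS nsqM IH. Qed.

Lemma nsq_prod n (f : 'I_n -> R[i]) : nsq (\prod_i f i) = \prod_i nsq (f i).
Proof. by apply: (big_morph nsq nsqM nsq1). Qed.

Lemma nsq_ge0 z : 0 <= nsq z.
Proof. by rewrite addr_ge0 ?sqr_ge0. Qed.

Lemma nsq_real x : nsq x%:C%C = x ^+ 2.
Proof. by rewrite /nsq /= expr0n /= addr0. Qed.

Lemma nsq_eq0 z : (nsq z == 0) = (z == 0).
Proof. by case: z => a b; rewrite /nsq /= paddr_eq0 ?sqr_ge0 // !sqrf_eq0 eq_complex. Qed.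

Definition cis y : R[i] := Complex (cos y) (sin y).

Lemma cisD x y : cis (x + y) = cis x * cis y.
Proof. by rewrite /cis cosD sinD [sin x * _ + _]addrC. Qed.

Lemma cis0 : cis 0 = 1.
Proof. by rewrite /cis cos0 sin0. Qed.

Lemma cisX y n : cis y ^+ n = cis (n%:R * y).
Proof.
elim: n => [|n IH]; first by rewrite mul0r cis0.
by rewrite exprS IH -cisD -natr1; congr cis; ring.
Qed.

Lemma nsq_cis y : nsq (cis y) = 1.
Proof. by rewrite /nsq /= cos2Dsin2. Qed.

Lemma cisN y : cis y * cis (- y) = 1.
Proof. by rewrite -cisD subrr cis0. Qed.

Lemma cisD_cisN y : cis y + cis (- y) = (2 * cos y)%:C%C.
Proof. by rewrite /cis cosN sinN; apply/eqP; rewrite eq_complex /= subrr mulr_natl mulr2n !eqxx. Qed.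

Lemma nsq_sub_bounds z (a : R) : 0 <= a -> nsq z = a ^+ 2 ->
  (a - 1) ^+ 2 <= nsq (z - 1) <= (a + 1) ^+ 2.
Proof.
move=> a0; case: z => x y; rewrite /nsq /= => E.
have xa : x ^+ 2 <= a ^+ 2 by rewrite -E lerDl sqr_ge0.
have : `|x| <= a by rewrite -(ger0_norm a0) -ler_sqr ?nnegrE ?normr_ge0 // !real_normK ?num_real.
rewrite ler_norml => /andP[x1 x2].
have : (x - 1) ^+ 2 + (y - 0) ^+ 2 = a ^+ 2 - 2 * x + 1 by rewrite -E; ring.
rewrite subr0 => ->; apply/andP; split; nra.
Qed.

(** A smaller power equal to [1] would have cosine [1], hence [sin(pi (i+1) / q) = 0] by the
    half-angle formula, although that angle lies strictly between [0] and [pi]. *)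
Lemma cis_prim_root q : (0 < q)%N -> q.-primitive_root (cis (2 * pi / q%:R)).
Proof.
move=> q0; have qn0 : q%:R != 0 :> R by rewrite pnatr_eq0; lia.
apply/andP; split => //; apply/forallP => i; rewrite unity_rootE cisX.
apply/eqP; case: (eqVneq i.+1 q) => [->|iq].
  rewrite mulrC divfK // mulrC mulr_natr; apply/eqP.
  by rewrite /cis cos2pi sin2pi.
apply/negbTE/negP => /eqP h.
have iq' : (i.+1 < q)%N by have := ltn_ord i; lia.
have := f_equal (@complex.Re R) h => /=.
set y := _ * _ => cy.
have yE : y = (pi * i.+1%:R / q%:R) *+ 2 by rewrite -mulr_natr /y; field.
move: cy; rewrite yE cos_mulr2n cos2sin2 => cy.
have sgt : 0 < sin (pi * i.+1%:R / q%:R : R).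
  apply: sin_gt0_pi; rewrite divr_gt0 ?mulr_gt0 ?pi_gt0 ?ltr0n //=.
  by rewrite ltr_pdivrMr ?ltr0n // ltr_pM2l ?pi_gt0 // ltr_nat.
have := exprn_gt0 2 sgt; lra.
Qed.

(** [V^q - 1] is factored twice, over the powers of a primitive root and over those of its
    conjugate; conjugate factors pair into real quadratics. *)
Lemma prod_sub_cis q (V : R[i]) : (0 < q)%N ->
  \prod_(i < q) (V ^+ 2 - (2 * cos (2 * pi * i%:R / q%:R))%:C%C * V + 1) = (V ^+ q - 1) ^+ 2.
Proof.
move=> q0; have prim := cis_prim_root q q0.
set e := cis _ in prim.
have primV : q.-primitive_root (cis (- (2 * pi / q%:R))).
  have -> : cis (- (2 * pi / q%:R)) = conjc (cis (2 * pi / q%:R)) :> R[i].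
    by rewrite /cis cosN sinN.
  by rewrite fmorph_primitive_root.
have P f : q.-primitive_root f -> \prod_(i < q) (V - f ^+ i) = V ^+ q - 1.
  move=> pf; have := f_equal (fun p => p.[V]) (factor_Xn_sub_1 pf).
  rewrite !hornerE horner_prod big_mkord => <-.
  by apply: eq_bigr => i _; rewrite !hornerE.
rewrite [RHS]expr2 -{1}(P _ prim) -(P _ primV) -big_split; apply: eq_bigr => i _ /=.
have -> : 2 * pi * i%:R / q%:R = i%:R * (2 * pi / q%:R) :> R by ring.
rewrite -cisD_cisN /e !cisX mulrN.
set y := _ * (_ / _).
have := cisN y; move: (cis y) (cis (- y)) => a b ab.
rewrite mulrBl !mulrBr ab; ring.
Qed.

End ComplexNorm.

(** * The Green function through the Joukowski map *)

Section Green.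
Context {R : realType}.
Implicit Types (r g s y c : R).

(* The Joukowski map sends the circle of radius [a] to an ellipse with semi-major axis
   [(a + 1/a) / 2]; this is that semi-axis for the ellipse through
   [v = (z + 1/z + 2 s^2) / (2 g^2)] with foci [+-1], where [|z| = r] and [c = cos (arg z)]. *)
Definition semiaxis r g s c : R :=
  let C := (r + r^-1) / 2 in let b := g ^+ 2 - s ^+ 2 in
  (C + c + Num.sqrt ((c - b * C) ^+ 2 + (1 - b ^+ 2) * (C ^+ 2 - 1))) / (2 * g ^+ 2).

(** Half of [log a], where [a >= 1] solves [a + 1/a = 2 semiaxis]: the mean of the Green functions
    of the arc [cos y <= g^2 - s^2] with poles at [0] and at infinity. *)
Definition green r g s c : R :=
  ln (semiaxis r g s c + Num.sqrt (semiaxis r g s c ^+ 2 - 1)) / 2.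

Section Params.
Variables (r g s : R).
Hypotheses (r01 : 0 < r < 1) (g0 : 0 < g) (s0 : 0 <= s) (gs : g ^+ 2 + s ^+ 2 = 1).

Let C := (r + r^-1) / 2.
Let b := g ^+ 2 - s ^+ 2.

Let r0 : 0 < r. Proof. by case/andP: r01. Qed.

Let C1 : 1 < C.
Proof.
have /andP[_ r1] := r01.
rewrite /C -subr_gt0.
have -> : (r + r^-1) / 2 - 1 = (1 - r) ^+ 2 / (2 * r) by field; rewrite gt_eqF.
by rewrite divr_gt0 ?exprn_gt0 ?subr_gt0 // mulr_gt0.
Qed.

Let gE : g ^+ 2 = 1 - s ^+ 2. Proof. by rewrite -gs addrK. Qed.
Let sE : s ^+ 2 = 1 - g ^+ 2. Proof. by rewrite gE; ring. Qed.
Let g2 : 0 < g ^+ 2. Proof. by rewrite exprn_gt0. Qed.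
Let s2 : 0 <= s ^+ 2. Proof. by rewrite exprn_ge0. Qed.

Let K0 : 0 <= (1 - b ^+ 2) * (C ^+ 2 - 1).
Proof.
have -> : 1 - b ^+ 2 = 4 * (g ^+ 2 * s ^+ 2).
  by rewrite /b; rewrite gE; ring.
have h : 0 <= g ^+ 2 * s ^+ 2 := mulr_ge0 (ltW g2) s2.
by apply: mulr_ge0; [exact: mulr_ge0 | rewrite subr_ge0 exprn_ege1 // ltW].
Qed.

(** For [K >= 0] the function [sqrt(x^2 + K)] is 1-Lipschitz, so any decrease of the root is
    compensated by the summand [c]. *)
Lemma semiaxis_homo c c' : c <= c' -> semiaxis r g s c <= semiaxis r g s c'.
Proof.
move=> cc; rewrite /semiaxis ler_pM2r ?invr_gt0 ?mulr_gt0 // -/C -/b -!addrA lerD2l.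
have := K0; set K := (1 - b ^+ 2) * _ => K0'.
set w := Num.sqrt ((c' - b * C) ^+ 2 + K).
have w0 : 0 <= w by rewrite sqrtr_ge0.
have wE : w ^+ 2 = (c' - b * C) ^+ 2 + K by rewrite sqr_sqrtr // addr_ge0 ?sqr_ge0.
have ww : - (c' - b * C) <= w.
  apply: le_trans (ler_norm _) _; rewrite normrN.
  by rewrite -ler_sqr ?nnegrE ?normr_ge0 // real_normK ?num_real // wE lerDl.
suff : Num.sqrt ((c - b * C) ^+ 2 + K) <= (c' - c) + w by lra.
have cw : 0 <= c' - c + w by rewrite addr_ge0 // subr_ge0.
rewrite -(ger0_norm cw) -sqrtr_sqr ler_sqrt ?sqr_ge0 //.
have -> : (c - b * C) ^+ 2 + K = w ^+ 2 + (c' - c) ^+ 2 + 2 * (c' - c) * - (c' - b * C).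
  by rewrite wE; ring.
have -> : (c' - c + w) ^+ 2 = w ^+ 2 + (c' - c) ^+ 2 + 2 * (c' - c) * w by ring.
by rewrite lerD2l ler_wpM2l // mulr_ge0 // subr_ge0.
Qed.

Lemma semiaxisN1 : semiaxis r g s (- 1) = 1 + (C - 1) / g ^+ 2.
Proof.
rewrite /semiaxis -/C -/b.
have bE : b = 1 - 2 * s ^+ 2 by rewrite /b gE; ring.
have -> : (-1 - b * C) ^+ 2 + (1 - b ^+ 2) * (C ^+ 2 - 1) = (C + b) ^+ 2 by ring.
rewrite sqrtr_sqr ger0_norm.
  rewrite bE; rewrite sE.
  by field; rewrite gt_eqF.
have : s ^+ 2 <= 1 by rewrite -gs lerDr ltW.
rewrite bE; have := C1; have := s2; lra.
Qed.

Lemma semiaxis1 : semiaxis r g s 1 = (C + s ^+ 2) / g ^+ 2.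
Proof.
rewrite /semiaxis -/C -/b.
have bE : b = 1 - 2 * s ^+ 2 by rewrite /b gE; ring.
have -> : (1 - b * C) ^+ 2 + (1 - b ^+ 2) * (C ^+ 2 - 1) = (C - b) ^+ 2 by ring.
rewrite sqrtr_sqr ger0_norm.
  by rewrite bE; field; rewrite gt_eqF.
rewrite bE; have := C1; have := s2; lra.
Qed.

(** The least semi-axis, taken at [c = -1]. It exceeds [1] because [r < 1], so its powers control
    the discretization of the equilibrium measure uniformly in the angle. *)
Definition axis_gap := 1 + (C - 1) / g ^+ 2.

Lemma axis_gap_gt1 : 1 < axis_gap.
Proof. by rewrite /axis_gap ltrDl divr_gt0 // subr_gt0. Qed.

Lemma axis_gap_le c : - 1 <= c -> axis_gap <= semiaxis r g s c.
Proof. by move=> h; rewrite /axis_gap -semiaxisN1 semiaxis_homo. Qed.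

Lemma green_homo c c' : - 1 <= c -> c <= c' -> green r g s c <= green r g s c'.
Proof.
move=> c1 cc; have h1 := axis_gap_le c c1; have h := semiaxis_homo c c' cc.
have h0 := axis_gap_gt1.
rewrite /green ler_pM2r ?invr_gt0 //.
set A := semiaxis r g s c in h1 h *; set A' := semiaxis _ _ _ _ in h *.
have A1 : 1 < A by apply: lt_le_trans h1.
have sA := sqrtr_ge0 (A ^+ 2 - 1); have sA' := sqrtr_ge0 (A' ^+ 2 - 1).
rewrite ler_ln ?posrE; [|lra|lra].
rewrite lerD // ler_sqrt; first by rewrite lerD2r lerXn2r ?nnegrE; lra.
by rewrite subr_ge0 exprn_ege1 //; lra.
Qed.

Lemma green_ge0 c : - 1 <= c -> 0 <= green r g s c.
Proof.
move=> c1; have h1 := axis_gap_le c c1; have h0 := axis_gap_gt1.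
rewrite /green divr_ge0 // ln_ge0 //.
have := sqrtr_ge0 (semiaxis r g s c ^+ 2 - 1); lra.
Qed.

Lemma green_semiaxis c (a : R) : 1 <= a -> a + a^-1 = 2 * semiaxis r g s c ->
  green r g s c = ln a / 2.
Proof.
move=> a1 aE; rewrite /green; congr (ln _ / 2).
have an0 : a != 0 by rewrite gt_eqF; lra.
have -> : semiaxis r g s c = (a + a^-1) / 2 by rewrite aE; field.
have -> : ((a + a^-1) / 2) ^+ 2 - 1 = ((a - a^-1) / 2) ^+ 2 by field.
rewrite sqrtr_sqr ger0_norm; first by field.
have : a^-1 <= 1 by rewrite invf_le1 //; lra.
move=> ?; apply: divr_ge0 => //; lra.
Qed.

(** The point [v = (V + 1/V) / 2] lies on an ellipse with foci [+-1] and
    [|v - 1| + |v + 1| = |V| + 1/|V|]. Both distances are explicit, as [2 g^2 z (v + 1) = (z + 1)^2]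
    and [2 g^2 z (v - 1) = z^2 + 1 - 2 b z]. *)
Lemma semiaxis_root y (z v V : R[i]) :
  z = r%:C%C * cis y -> z ^+ 2 + 1 + (2 * s ^+ 2)%:C%C * z = (2 * g ^+ 2)%:C%C * z * v ->
  V ^+ 2 + 1 = 2%:R * V * v ->
  nsq V + 1 = 2 * Num.sqrt (nsq V) * semiaxis r g s (cos y).
Proof.
move=> zE vE VE.
have nz : nsq z = r ^+ 2 by rewrite zE nsqM nsq_real nsq_cis mulr1.
have zn0 : z != 0 by rewrite -nsq_eq0 nz expf_neq0 // gt_eqF.
have nsq2 (k : R) : nsq k%:C%C = k ^+ 2 by exact: nsq_real.
set P := nsq V.
have P0 : 0 <= P := nsq_ge0 V.
have two : (2%:R : R[i]) = (2 : R)%:C%C by rewrite rmorph_nat.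
have step (e : R) : e ^+ 2 = 1 -> nsq (V + e%:C%C) = 2 * Num.sqrt P * Num.sqrt (nsq (v + e%:C%C)).
  move=> e2.
  have E : (V + e%:C%C) ^+ 2 = (2 : R)%:C%C * V * (v + e%:C%C).
    have ee : (e%:C)%C ^+ 2 = 1 :> R[i] by rewrite -rmorphXn /= e2.
    rewrite mulrDr -two -VE sqrrD ee mulr_natl mulr2n; ring.
  have := f_equal nsq E; rewrite nsqX !nsqM nsq2 => E'.
  have nn := nsq_ge0 (V + e%:C%C).
  rewrite -[LHS](ger0_norm nn) -sqrtr_sqr E'.
  by rewrite -mulrA sqrtrM ?sqr_ge0 // sqrtr_sqr normr_nat sqrtrM ?nsq_ge0 // mulrA.
have sum : nsq (V + 1%:C%C) + nsq (V + (-1)%:C%C) = 2 * (P + 1).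
  by rewrite /P; case: (V) => x1 y1; rewrite /nsq /=; ring.
move: sum; rewrite (step 1) ?expr1n // (step (-1)) ?sqrrN ?expr1n // => sum.
suff : Num.sqrt (nsq (v + 1%:C%C)) + Num.sqrt (nsq (v + (-1)%:C%C)) = 2 * semiaxis r g s (cos y).
  by move: sum => /[swap] h; rewrite -mulrDr h; lra.
have gn0 : g != 0 by rewrite gt_eqF.
have rn0 : r != 0 by rewrite gt_eqF.
have s2E := sE.
have root (e : R) (w : R[i]) (x : R) : 0 <= x -> (2 * g ^+ 2)%:C%C * z * (v + e%:C%C) = w ->
    nsq w = (2 * g ^+ 2 * r * x) ^+ 2 -> Num.sqrt (nsq (v + e%:C%C)) = x.
  move=> x0 <-; rewrite !nsqM nsq2 nz => h.
  have -> : nsq (v + e%:C%C) = x ^+ 2.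
    apply: (mulfI (x := (2 * g ^+ 2) ^+ 2 * r ^+ 2)).
      by rewrite mulf_neq0 ?expf_neq0 ?mulf_neq0 ?expf_neq0 ?pnatr_eq0.
    by rewrite h; ring.
  by rewrite sqrtr_sqr ger0_norm.
have c1 := cos_geN1 y.
have Cpc : 0 <= C + cos y by have := C1; lra.
rewrite (root 1 ((z + 1) ^+ 2) ((C + cos y) / g ^+ 2)); first last.
- rewrite nsqX.
  have -> : nsq (z + 1) = 2 * r * (C + cos y).
    rewrite zE /nsq /= /C; have := cos2Dsin2 y => cs.
    transitivity (r ^+ 2 * (cos y ^+ 2 + sin y ^+ 2) + 1 + 2 * r * cos y); first by ring.
    by rewrite cs; field.
  by field.
- rewrite mulrDr -vE s2E; move: (z) => w; rewrite !rmorphM !rmorphB /= !rmorphXn /= !rmorph_nat !rmorph1; ring.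
- by rewrite divr_ge0 ?(ltW g2).
set S := Num.sqrt ((cos y - b * C) ^+ 2 + (1 - b ^+ 2) * (C ^+ 2 - 1)).
have S2 : S ^+ 2 = (cos y - b * C) ^+ 2 + (1 - b ^+ 2) * (C ^+ 2 - 1).
  by rewrite sqr_sqrtr // addr_ge0 ?sqr_ge0.
rewrite (root (-1) (z ^+ 2 + 1 - (2 * b)%:C%C * z) (S / g ^+ 2)); first last.
- have -> : (2 * g ^+ 2 * r * (S / g ^+ 2)) ^+ 2 = 4 * r ^+ 2 * S ^+ 2 by field.
  rewrite S2 /b s2E zE /nsq expr2 /= /C; have := sin2cos2 y => snE.
  transitivity ((r ^+ 2 * (cos y ^+ 2 - sin y ^+ 2) + 1 - 2 * (g ^+ 2 - (1 - g ^+ 2)) * r * cos y) ^+ 2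
     + sin y ^+ 2 * (2 * r ^+ 2 * cos y - 2 * (g ^+ 2 - (1 - g ^+ 2)) * r) ^+ 2); first by ring.
  by rewrite snE; field.
- rewrite mulrDr -vE /b s2E; move: (z) => w; rewrite !rmorphM !rmorphB /= !rmorphXn /= rmorphN !rmorph_nat !rmorph1; ring.
- by rewrite divr_ge0 ?(ltW g2) // sqrtr_ge0.
by rewrite /semiaxis -/C -/b -/S; field.
Qed.

End Params.
End Green.

(** * Discretization of the equilibrium measure *)

Section Equilibrium.
Context {R : realType}.
Implicit Types (r g s y c : R) (q N : nat).

(* Zeros of a Chebyshev-type polynomial of the arc complementary to the gap: equal masses
   at [+-eq_angle] discretize the equilibrium measure of that arc. *)
Definition eq_angle q g s (i : 'I_q) : R :=
  acos (g ^+ 2 * cos (2 * pi * i%:R / q%:R) - s ^+ 2).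

(** The factors at [+-eq_angle] multiply to [w i = 2 g^2 z (v - cos(2 pi i / q))]. Their product is,
    up to explicit powers, [(V^q - 1)^2 / V^q], and replacing [|V^q - 1|] by [|V|^q] costs a bounded
    factor, that is [1/q] after averaging the logarithms. *)
Lemma avg_logker_green q r g s y :
  0 < r < 1 -> 0 < g -> 0 <= s -> g ^+ 2 + s ^+ 2 = 1 -> (0 < q)%N ->
  2 <= axis_gap r g ^+ q ->
  `|(\sum_(i < q) (logker r (y - eq_angle q g s i) + logker r (y + eq_angle q g s i))) / (2 * q%:R)
    - (ln g + ln r / 2 + green r g s (cos y))| <= q%:R^-1.
Proof.
move=> r01 g0 s0 gs q0 gap2; have /andP[r0 r1] := r01.
have qR : 0 < q%:R :> R by rewrite ltr0n.
pose z := r%:C%C * cis y.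
have nz : nsq z = r ^+ 2 by rewrite nsqM nsq_real nsq_cis mulr1.
have zn0 : z != 0 by rewrite -nsq_eq0 nz expf_neq0 // gt_eqF.
have g2 : 0 < g ^+ 2 by rewrite exprn_gt0.
have s2 : 0 <= s ^+ 2 by rewrite exprn_ge0.
have gn0 : (2 * g ^+ 2)%:C%C != 0 :> R[i].
  by rewrite -nsq_eq0 nsq_real !expf_neq0 // gt_eqF // mulr_gt0.
pose v := (z ^+ 2 + 1 + (2 * s ^+ 2)%:C%C * z) / ((2 * g ^+ 2)%:C%C * z).
have vE : z ^+ 2 + 1 + (2 * s ^+ 2)%:C%C * z = (2 * g ^+ 2)%:C%C * z * v.
  by rewrite /v [RHS]mulrC divfK // mulf_neq0.
(* Inverse Joukowski map: the two roots [v + d] and [v - d] have product [1], so one of them has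
   modulus at least [1]. *)
have [V VE V1] : exists2 V : R[i], V ^+ 2 + 1 = 2%:R * V * v & 1 <= nsq V.
  pose d := sqrtc (v ^+ 2 - 1).
  have d2 : d ^+ 2 = v ^+ 2 - 1 by rewrite sqr_sqrtc.
  have E1 : (v + d) ^+ 2 + 1 = 2%:R * (v + d) * v.
    by rewrite sqrrD d2 -mulr_natl; ring.
  have E2 : (v - d) ^+ 2 + 1 = 2%:R * (v - d) * v.
    by rewrite sqrrB d2 -mulr_natl; ring.
  have : nsq (v + d) * nsq (v - d) = 1.
    by rewrite -nsqM mulrC -subr_sqr d2 opprB addrC subrK nsq1.
  have [h|h] := leP 1 (nsq (v + d)); first by exists (v + d).
  move=> h1; exists (v - d) => //.
  have := nsq_ge0 (v + d); have := nsq_ge0 (v - d); nra.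
pose a := Num.sqrt (nsq V).
have aP : a ^+ 2 = nsq V by rewrite sqr_sqrtr // nsq_ge0.
have a1 : 1 <= a by rewrite -(sqrtr1 R) ler_sqrt // nsq_ge0.
have a0 : 0 < a by lra.
have aE : a + a^-1 = 2 * semiaxis r g s (cos y).
  have := semiaxis_root r g s r01 g0 s0 gs y z v V erefl vE VE.
  rewrite -/a -aP => h; apply: (mulIf (x := a)); first by rewrite gt_eqF.
  by rewrite mulrDl mulVf ?gt_eqF // -expr2 h; ring.
have aq2 : 2 <= a ^+ q.
  apply: le_trans gap2 _; rewrite lerXn2r ?nnegrE ?(ltW a0) //.
    by have := axis_gap_gt1 r g r01 g0; lra.
  apply: le_trans (axis_gap_le r g s r01 g0 s0 gs _ (cos_geN1 y)) _.
  have : a^-1 <= a by apply: (@le_trans _ _ 1) => //; rewrite invf_le1.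
  lra.
rewrite (green_semiaxis r g s (cos y) a) //.
pose w (i : 'I_q) := 1 - (2 * cos (eq_angle q g s i))%:C%C * z + z ^+ 2.
have cosE i : cos (eq_angle q g s i) = g ^+ 2 * cos (2 * pi * i%:R / q%:R) - s ^+ 2.
  rewrite acosK // in_itv /=.
  have := cos_geN1 (2 * pi * i%:R / q%:R : R); have := cos_le1 (2 * pi * i%:R / q%:R : R).
  by move=> h1 h2; apply/andP; split; nra.
have logE i : logker r (y - eq_angle q g s i) + logker r (y + eq_angle q g s i) = ln (nsq (w i)) / 2.
  rewrite /logker -mulrDl -lnM ?posrE ?logker_arg_gt0 ?(ltW r0) //.
  congr (ln _ / 2); rewrite /w /z /nsq expr2 /=.
  set t := eq_angle _ _ _ _; rewrite cosB cosD.
  have := sin2cos2 y; have := sin2cos2 t => st sy.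
  transitivity ((1 + r ^+ 2 - 2 * r * (cos y * cos t)) ^+ 2 - 4 * r ^+ 2 * sin y ^+ 2 * sin t ^+ 2).
    by ring.
  rewrite [RHS](_ : _ = (1 - 2 * cos t * r * cos y + r ^+ 2 * (cos y ^+ 2 - sin y ^+ 2)) ^+ 2
     + sin y ^+ 2 * (2 * r ^+ 2 * cos y - 2 * cos t * r) ^+ 2); last by ring.
  by rewrite sy st; ring.
have w0 i : 0 < nsq (w i).
  have : w i = (1 - r%:C%C * cis (y - eq_angle q g s i)) * (1 - r%:C%C * cis (y + eq_angle q g s i)).
    rewrite /w /z !cisD -cisD_cisN; have := cisN (eq_angle q g s i).
    move: (cis (eq_angle _ _ _ _)) (cis (- _)) => e f ef.
    transitivity (1 - (e + f) * (r%:C%C * cis y) + (r%:C%C * cis y) ^+ 2 * (e * f)).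
      by rewrite ef mulr1.
    by ring.
  have nn (x : R) : nsq (1 - r%:C%C * cis x) != 0.
    rewrite nsq_eq0 subr_eq0; apply/eqP => /(f_equal nsq).
    rewrite nsq1 nsqM nsq_real nsq_cis mulr1 => h.
    by have : r ^+ 2 < 1 by [rewrite exprn_ilt1 // ltW]; rewrite -h ltxx.
  by move=> ->; rewrite lt_neqAle nsq_ge0 andbT eq_sym nsqM mulf_neq0.
(* Here [V w i = g^2 z (V^2 - 2 cos(2 pi i / q) V + 1)], and [prod_sub_cis] multiplies these
   quadratics. *)
have prodE : (\prod_i nsq (w i)) * (a ^+ 2) ^+ q = (g ^+ 4 * r ^+ 2) ^+ q * nsq (V ^+ q - 1) ^+ 2.
  rewrite -nsqX -(prod_sub_cis q V q0) nsq_prod.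
  have powE (x : R) : x ^+ q = \prod_(i < q) x by rewrite prodr_const card_ord.
  rewrite !powE -!big_split; apply: eq_bigr => i _ /=.
  rewrite aP -nz.
  have <- : nsq ((g ^+ 2)%:C%C) = g ^+ 4 by rewrite nsq_real -exprM.
  rewrite -!nsqM; congr nsq.
  have e1 : w i = (g ^+ 2)%:C%C * z * (2%:R * v - (2 * cos (2 * pi * i%:R / q%:R))%:C%C).
    rewrite /w cosE; set c := cos (_ / _).
    transitivity ((2 * g ^+ 2)%:C%C * z * v - (2 * g ^+ 2 * c)%:C%C * z).
      by rewrite -vE; move: (z) => u; rewrite !(rmorphM, rmorphB) /= !rmorph_nat; ring.
    by rewrite !(rmorphM, rmorphB) /= !rmorph_nat; ring.
  rewrite e1; set X := ((2 * _)%:C%C : R[i]).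
  have -> : V ^+ 2 - X * V + 1 = V ^+ 2 + 1 - X * V by ring.
  rewrite VE; ring.
have Qb := nsq_sub_bounds (V ^+ q) (a ^+ q) _ _.
have {Qb}/andP[Q1 Q2] : (a ^+ q - 1) ^+ 2 <= nsq (V ^+ q - 1) <= (a ^+ q + 1) ^+ 2.
  by apply: Qb; rewrite ?exprn_ge0 ?(ltW a0) // nsqX -aP -!exprM mulnC.
have Q0 : 0 < nsq (V ^+ q - 1).
  by apply: lt_le_trans Q1; rewrite exprn_gt0 // subr_gt0; lra.
set Q := nsq (V ^+ q - 1) in Q0 Q1 Q2 prodE.
have lnprod : ln (\prod_i nsq (w i)) = \sum_i ln (nsq (w i)).
  rewrite -[RHS]expRK expR_sum; congr ln.
  by apply: eq_bigr => i _; rewrite lnK // posrE.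
have W0 : 0 < \prod_i nsq (w i) by rewrite prodr_gt0.
have := f_equal (@ln R) prodE.
rewrite !lnM ?posrE ?exprn_gt0 ?mulr_gt0 ?exprn_gt0 // -!exprM !lnXn ?exprn_gt0 ?mulr_gt0 ?exprn_gt0 //.
rewrite lnM ?posrE ?exprn_gt0 // !lnXn // lnprod => lnE.
(* As [|V|^q >= 2], the modulus of [V^q - 1] lies between half and twice [|V|^q]; [ln 2 <= 1] turns
   this into an additive error of at most [1] on either side. *)
have lnQ2 : ln Q <= 2 * (1 + q%:R * ln a).
  apply: (@le_trans _ _ (ln ((2 * a ^+ q) ^+ 2))).
    rewrite ler_ln ?posrE ?exprn_gt0 ?mulr_gt0 ?exprn_gt0 //.
    apply: le_trans Q2 _; rewrite lerXn2r ?nnegrE ?addr_ge0 ?mulr_ge0 ?exprn_ge0 ?(ltW a0) //; lra.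
  rewrite lnXn ?mulr_gt0 ?exprn_gt0 // lnM ?posrE ?exprn_gt0 // lnXn //.
  rewrite -(mulr_natl (ln a)) -(mulr_natl (_ + _)) ler_pM2l // lerD2r.
  have := @le_ln1Dx R 1; rewrite -[1 + 1]/(2); apply; lra.
have lnQ1 : 2 * (q%:R * ln a - 1) <= ln Q.
  apply: (@le_trans _ _ (ln ((a ^+ q / 2) ^+ 2))); last first.
    rewrite ler_ln ?posrE ?exprn_gt0 ?divr_gt0 ?exprn_gt0 //.
    apply: le_trans Q1; rewrite lerXn2r ?nnegrE ?subr_ge0 ?divr_ge0 ?exprn_ge0 ?(ltW a0) //; lra.
  rewrite lnXn ?divr_gt0 ?exprn_gt0 // ln_div ?posrE ?exprn_gt0 // lnXn //.
  rewrite -(mulr_natl (ln a)) -(mulr_natl (_ - _)) ler_pM2l // lerD2l lerN2.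
  have := @le_ln1Dx R 1; rewrite -[1 + 1]/(2); apply; lra.
rewrite (eq_bigr _ (fun i _ => logE i)) -mulr_suml.
move: lnE; set S := \sum_i _ => lnE.
have -> : S / 2 / (2 * q%:R) - (ln g + ln r / 2 + ln a / 2) =
   (ln Q / 2 - q%:R * ln a) / q%:R.
  have -> : S = (ln g *+ 4 + ln r *+ 2) *+ q + ln Q *+ 2 - ln a *+ (2 * q) by rewrite -lnE addrK.
  rewrite -(mulr_natr (ln g)) -(mulr_natr (ln r)) -(mulr_natr (ln Q)) -(mulr_natr (ln a)).
  rewrite -(mulr_natr (_ + _)) natrM; field.
  by rewrite gt_eqF.
rewrite normrM normfV (gtr0_norm qR) -[leRHS]mul1r ler_pM2r ?invr_gt0 // ler_norml.
by apply/andP; split; lra.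
Qed.

End Equilibrium.

(** * The bound for points on the circle *)

Section MaxMean.
Context {R : realType}.
Implicit Types (x y a b : R) (N M m : nat).

Lemma cos_le_between a y : 0 <= a -> a <= y <= 2 * pi - a -> cos y <= cos a.
Proof.
move=> a0 /andP[ay ya].
wlog ypi : y ay ya / y <= pi.
  move=> W; case: (leP y pi) => ypi; first exact: W.
  have -> : cos y = cos (2 * pi - y).
    by rewrite -cosN -(cosD2pin (- y) 1); congr cos; ring.
  by apply: W; lra.
move: ay; rewrite le_eqVlt => /orP[/eqP -> //|ay].
by rewrite ltW // ltr_cos ?in_itv //=; apply/andP; split; lra.
Qed.

Lemma sum_periodic M (f : nat -> R) k : (forall m, f (m + M)%N = f m) ->
  \sum_(m < M) f (k + m)%N = \sum_(m < M) f m.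
Proof.
move=> fM; elim: k => [|k <-] //.
case: M fM => [|M] fM; first by rewrite !big_ord0.
rewrite big_ord_recr big_ord_recl /= addn0 addrC; congr (_ + _).
  by rewrite addSnnS fM.
by apply: eq_bigr => m _; rewrite /bump /= add1n addSnnS.
Qed.

Lemma cos_grid_periodic M m y : (0 < M)%N ->
  cos (grid M (m + M) - y) = cos (grid M m - y).
Proof.
move=> M0; have Mn0 : M%:R != 0 :> R by rewrite pnatr_eq0; lia.
rewrite -(cosD2pin (grid M m - y) 1); congr cos.
by rewrite /grid natrD; field.
Qed.

(** [h] is just past the midpoint of [w] and [M]. With an arc occupying the indices [0] to [w] of a
    cycle of length [M], the points beyond it and before [h] are at least as near to its right end,
    those from [h] on to its left end. *)
Lemma half_window M w : (w.+1 < M)%N -> exists h, [/\ (w.+1 <= h)%N, (h <= M)%N,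
  forall i, (i < h - w)%N -> (i + w + i <= M)%N & forall i, (h <= i)%N -> (M - i <= i - w)%N].
Proof.
move=> wM; exists ((M + w)./2).+1.
by have := odd_double_half (M + w); rewrite -muln2; split=> [||i|i]; lia.
Qed.

(** [X (cos y)] never increases with the distance of [y] from [0]. A grid point on the arc
    contributes at most [X 1]; one off the arc is compared with the nearer end, and the two
    resulting tails fit into one period of the sum without translates. *)
Lemma sum_max_translates_le M n (th : 'I_n -> R) (J : pred 'I_n) (X : R -> R) a b :
  (0 < M)%N ->
  (forall c c', - 1 <= c -> c <= c' -> X c <= X c') -> 0 <= X (- 1) ->
  0 <= a <= b -> (forall j, J j -> a <= th j <= b) ->
  \sum_(m < M) \big[Order.max/0]_(j | J j) X (cos (grid M m - th j)) <=
  ((b - a) / (2 * pi) * M%:R + 3) * X 1 + \sum_(m < M) X (cos (grid M m)).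
Proof.
move=> M0 Xh X0 /andP[a0 ab] Jab.
have MR : 0 < M%:R :> R by rewrite ltr0n.
have p0 : 0 < 2 * pi :> R by rewrite mulr_gt0 ?pi_gt0.
have Xge c : - 1 <= c -> 0 <= X c by move=> h; apply: le_trans X0 _; exact: Xh.
have X1 : 0 <= X 1 by apply: Xge; lra.
pose G m := \big[Order.max/0]_(j | J j) X (cos (grid M m - th j)).
have GM m : G (m + M)%N = G m.
  by apply: eq_bigr => j _; rewrite cos_grid_periodic.
have Gle m c : - 1 <= c -> (forall j, J j -> cos (grid M m - th j) <= c) -> G m <= X c.
  by move=> c1 h; apply: bigmax_le => [|j Jj]; [exact: Xge | apply: Xh; rewrite ?cos_geN1 // h].
(* [A] rounds the left end of the arc down to the grid, [B] rounds the right end up. *)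
pose A := Num.truncn (a * M%:R / (2 * pi)).
pose B := (Num.truncn (b * M%:R / (2 * pi))).+1.
have A1 : A%:R <= a * M%:R / (2 * pi).
  by rewrite truncn_le // divr_ge0 ?(ltW p0) // mulr_ge0 ?(ltW MR).
have A2 : a * M%:R / (2 * pi) < A.+1%:R by rewrite truncnS_gt.
have B1 : b * M%:R / (2 * pi) <= B%:R by rewrite ltW // truncnS_gt.
have B2 : B%:R <= b * M%:R / (2 * pi) + 1.
  by rewrite /B -natr1 lerD2r truncn_le // divr_ge0 ?(ltW p0) // mulr_ge0 ?(ltW MR) //; lra.
have gA : grid M A <= a.
  by rewrite /grid ler_pdivrMr // mulrC -ler_pdivlMr.
have gB : b <= grid M B.
  by rewrite /grid ler_pdivlMr // [leRHS]mulrC -ler_pdivrMr.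
have AB : (A < B)%N.
  rewrite -(ltr_nat R); apply: (le_lt_trans A1); apply: (@le_lt_trans _ _ (b * M%:R / (2 * pi))).
    by rewrite ler_pM2r ?invr_gt0 // ler_pM2r.
  by rewrite truncnS_gt.
pose w := (B - A)%N.
(* Rounding adds at most two steps, and counting both end points adds one more. *)
have wE : w%:R + 1 <= (b - a) / (2 * pi) * M%:R + 3.
  rewrite /w natrB 1?ltnW //.
  have -> : (b - a) / (2 * pi) * M%:R = b * M%:R / (2 * pi) - a * M%:R / (2 * pi) by ring.
  move: A2 B2; rewrite -[A.+1%:R]natr1; lra.
have S0 : 0 <= \sum_(m < M) X (cos (grid M m)).
  by apply: sumr_ge0 => m _; rewrite Xge ?cos_geN1.
(* If the rounded arc exhausts the grid, every term is bounded by [X 1]. *)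
case: (leqP M w.+1) => wM.
  have : \sum_(m < M) G m <= M%:R * X 1.
    rewrite -sum_grid_const; apply: ler_sum => m _.
    by apply: Gle => [|j _]; [lra | exact: cos_le1].
  have : M%:R * X 1 <= ((b - a) / (2 * pi) * M%:R + 3) * X 1.
    apply: ler_wpM2r => //; apply: le_trans wE.
    by rewrite natr1 ler_nat.
  rewrite /G; lra.
(* The indices are rotated to start at the left end of the arc. *)
rewrite -[leLHS](sum_periodic M G A GM).
rewrite -(big_mkord xpredT (fun m => G (A + m)%N)) (@big_cat_nat _ _ _ w.+1) //=; last exact: ltnW.
apply: lerD.
  rewrite big_mkord; apply: (@le_trans _ _ (w.+1%:R * X 1)).
    rewrite -sum_grid_const; apply: ler_sum => m _.
    by apply: Gle => [|j _]; [lra | exact: cos_le1].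
  by apply: ler_wpM2r => //; rewrite -natr1.
pose f i := X (cos (grid M i)).
have f0 i : 0 <= f i by rewrite Xge ?cos_geN1.
have gD i k : grid M (i + k) = grid M i + grid M k :> R by rewrite /grid natrD; ring.
have gle i k : (i <= k)%N -> grid M i <= grid M k :> R.
  move=> ik; rewrite /grid; apply: ler_wpM2r; [by rewrite invr_ge0 ltW | apply: ler_wpM2l; first exact: ltW].
  by rewrite ler_nat.
have g0 i : 0 <= grid M i :> R by rewrite divr_ge0 ?mulr_ge0 ?(ltW p0) ?pi_ge0 ?(ltW MR).
have gM : grid M M = 2 * pi :> R by rewrite /grid mulfK // gt_eqF.
have [h [hw hM h1 h2]] := half_window M w wM.
have BA : B = (A + w)%N by rewrite /w subnKC // ltnW.
have bnd i j : (w < i)%N -> J j -> grid M (i - w) <= grid M (A + i) - th j <= grid M i.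
  move=> wi Jj; have /andP[j1 j2] := Jab j Jj.
  have : grid M (A + i) = grid M B + grid M (i - w) :> R by rewrite -gD BA -addnA subnKC // ltnW.
  have := gD A i; lra.
rewrite (@big_cat_nat _ _ _ h) //=.
(* Past the right end the distance is at least [i - w] steps, before the left end at least [M - i].
   The two ranges of [f] obtained are disjoint parts of one period. *)
apply: (@le_trans _ _ (\sum_(1 <= i < (h - w)) f i + \sum_(h <= i < M) f i)).
  apply: lerD.
    rewrite -{1}(addn1 w) addnC -{1}(subnK (ltnW hw)) big_addn.
    rewrite addnK.
    apply: ler_sum_nat => i /andP[i1 i2].
    apply: Gle => [|j Jj]; first exact: cos_geN1.
    have /andP[k1 k2] := bnd (i + w)%N j (leq_add i1 (leqnn w)) Jj.
    rewrite addnK in k1.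
    apply: cos_le_between => //; rewrite k1 /=; apply: le_trans k2 _.
    rewrite lerBrDr -gM -gD; by apply: gle; rewrite h1.
  apply: ler_sum_nat => i /andP[i1 i2].
  apply: Gle => [|j Jj]; first exact: cos_geN1.
  have /andP[k1 k2] := bnd i j (leq_trans hw i1) Jj.
  have E : 2 * pi - grid M i = grid M (M - i) :> R.
    by rewrite -gM -(addrK (grid M i) (grid M (M - i))) -gD subnK // ltnW.
  have -> : cos (grid M i) = cos (2 * pi - grid M i) :> R.
    by rewrite -cosN -(cosD2pin (- grid M i) 1); congr cos; ring.
  apply: cos_le_between; first by rewrite E.
  apply/andP; split; last by apply: le_trans k2 _; lra.
  rewrite E; by apply: le_trans k1; apply: gle; exact: h2.
rewrite -(big_mkord xpredT f) [leRHS](@big_cat_nat _ _ _ 1) //= [X in _ <= _ + X](@big_cat_nat _ _ _ (h - w)) //=; [|by rewrite subn_gt0|by rewrite (leq_trans (leq_subr _ _))].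
rewrite [X in _ <= _ + (_ + X)](@big_cat_nat _ _ _ h) //=; last exact: leq_subr.
have s1 : 0 <= \sum_(0 <= i < 1) f i by apply: sumr_ge0.
have s2 : 0 <= \sum_(h - w <= i < h) f i by apply: sumr_ge0.
lra.
Qed.

End MaxMean.

(** * Choice of the parameters and the arc inequality *)

Section ArcBound.
Context {R : realType}.
Implicit Types (x y a b t : R) (N M n : nat).

(** Here [g = 1 / cosh t] and [s = tanh t], so [(1 + s^2) / g^2 = cosh(2t)]. The peak semi-axis is
    at least this, because [(r + 1/r) / 2 >= 1], and half its inverse hyperbolic cosine is at least
    [t]. *)
Lemma green_cosh r t : 0 < r < 1 -> 0 < t ->
  let g := 2 / (expR t + expR (- t)) in
  let s := (expR t - expR (- t)) / (expR t + expR (- t)) in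
  [/\ 0 < g, 0 <= s, g ^+ 2 + s ^+ 2 = 1 & t <= green r g s 1].
Proof.
move=> r01 t0 g s; have /andP[r0 r1] := r01.
set E := expR t in g s *; set F := expR (- t) in g s *.
have E1 : 1 < E by rewrite expR_gt1.
have F0 : 0 < F by exact: expR_gt0.
have EF : E * F = 1 by rewrite -expRD subrr expR0.
have EF0 : 0 < E + F by lra.
have FE : F <= E by nra.
have g0 : 0 < g by rewrite divr_gt0.
have s0 : 0 <= s by rewrite divr_ge0 ?(ltW EF0) // subr_ge0.
have gs : g ^+ 2 + s ^+ 2 = 1.
  have -> : g ^+ 2 + s ^+ 2 = (4 * (E * F) + (E - F) ^+ 2) / (E + F) ^+ 2.
    by rewrite EF /g /s; field; rewrite gt_eqF.
  have -> : 4 * (E * F) + (E - F) ^+ 2 = (E + F) ^+ 2 by ring.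
  by rewrite divff // expf_neq0 // gt_eqF.
split => //.
have A1 := semiaxis1 r g s r01 g0 s0 gs.
have A2 : (E ^+ 2 + F ^+ 2) / 2 <= semiaxis r g s 1.
  rewrite A1.
  have -> : (E ^+ 2 + F ^+ 2) / 2 = (1 + s ^+ 2) / g ^+ 2.
    by rewrite /g /s; field; rewrite gt_eqF.
  rewrite ler_pM2r ?invr_gt0 ?exprn_gt0 // lerD2r -subr_ge0.
  have -> : (r + r^-1) / 2 - 1 = (1 - r) ^+ 2 / (2 * r) by field; rewrite gt_eqF.
  by rewrite divr_ge0 ?sqr_ge0 // mulr_ge0 // ltW.
rewrite /green; set A := semiaxis _ _ _ _ in A2 *.
rewrite ler_pdivlMr // -[leLHS]expRK.
have -> : expR (t * 2) = E ^+ 2 by rewrite expRM_natr.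
have EF2 : E ^+ 2 * F ^+ 2 = 1 by rewrite -exprMn EF expr1n.
have sq : (E ^+ 2 - F ^+ 2) / 2 <= Num.sqrt (A ^+ 2 - 1).
  have h0 : 0 <= (E ^+ 2 - F ^+ 2) / 2.
    by rewrite divr_ge0 // subr_ge0 lerXn2r ?nnegrE //; lra.
  rewrite -[leLHS](ger0_norm h0) -sqrtr_sqr; apply: ler_wsqrtr.
  have -> : ((E ^+ 2 - F ^+ 2) / 2) ^+ 2 = ((E ^+ 2 + F ^+ 2) / 2) ^+ 2 - E ^+ 2 * F ^+ 2 by field.
  rewrite EF2 lerD2r lerXn2r ?nnegrE //.
    by rewrite divr_ge0 // addr_ge0 ?sqr_ge0.
  by apply: le_trans A2; rewrite divr_ge0 // addr_ge0 ?sqr_ge0.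
have E0 : 0 < E ^+ 2 by rewrite exprn_gt0 //; lra.
rewrite ler_ln ?posrE //; lra.
Qed.

(** Adding [x] to every factor costs most when all factors take their largest value [4], the maximum
    of [2 - 2 cos]. *)
Lemma prod_addl_le n (f : 'I_n -> R) x : 0 <= x -> (forall i, 0 <= f i <= 4) ->
  \prod_i (f i + x) <= \prod_i f i + ((4 + x) ^+ n - 4 ^+ n).
Proof.
move=> x0; elim: n f => [|n IH] f f04; first by rewrite !big_ord0 !expr0; lra.
rewrite !big_ord_recr /=.
have := IH (fun i => f (widen_ord (leqnSn n) i)) (fun i => f04 _).
set P := \prod_i _; set P' := \prod_i _; set u := (4 + x) ^+ n; set v := 4 ^+ n => h.
have /andP[f0 f4] := f04 ord_max.
have P'v : P' <= v.
  have -> : v = \prod_(i < n) 4 by rewrite prodr_const card_ord.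
  by apply: ler_prod => i _; exact: f04.
have uv : v <= u by rewrite lerXn2r ?nnegrE //; lra.
rewrite !exprS -/u -/v.
have h1 : P * (f ord_max + x) <= (P' + (u - v)) * (f ord_max + x).
  by rewrite ler_wpM2r // addr_ge0.
have h2 : (u - v) * (f ord_max + x) <= (u - v) * (4 + x).
  by rewrite ler_wpM2l ?subr_ge0 // lerD2r.
have h3 : P' * x <= v * x by rewrite ler_wpM2r.
lra.
Qed.

Lemma expr4D_le n x : 0 <= x <= 1 -> (4 + x) ^+ n <= 4 ^+ n + x * (n%:R * 5 ^+ n).
Proof.
move=> /andP[x0 x1]; elim: n => [|n IH]; first by rewrite !expr0 mul0r mulr0 addr0.
rewrite !exprS -[n.+1%:R]natr1.
have u45 : (4 : R) ^+ n <= 5 ^+ n by rewrite lerXn2r ?nnegrE ?ler_nat.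
set u := (4 + x) ^+ n in IH *; set v := 4 ^+ n in u45 IH *; set w := 5 ^+ n in u45 IH *.
have v0 : 0 <= v by rewrite exprn_ge0.
have w0 : 0 <= w by rewrite exprn_ge0.
have n0 : 0 <= n%:R :> R by rewrite ler0n.
have h : (4 + x) * u <= (4 + x) * (v + x * (n%:R * w)) by rewrite ler_wpM2l //; lra.
apply: le_trans h _.
have xnw : 0 <= x * (n%:R * w) by rewrite !mulr_ge0.
have xv : x * v <= x * w by rewrite ler_wpM2l.
have xw : 0 <= x * w by rewrite mulr_ge0.
have h2 : x * (x * (n%:R * w)) <= x * (n%:R * w) by rewrite ler_piMl.
lra.
Qed.

Lemma avglog_green q r g s N (e : R) y :
  0 < r < 1 -> 0 < g -> 0 <= s -> g ^+ 2 + s ^+ 2 = 1 -> (0 < q)%N ->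
  2 <= axis_gap r g ^+ q -> (forall y, `|tlog N r y - logker r y| <= e) ->
  `|avglog q (eq_angle q g s) N r y - (ln g + ln r / 2 + green r g s (cos y))| <= e + q%:R^-1.
Proof.
move=> r01 g0 s0 gs q0 gapq HN.
have h1 := avg_logker_green q r g s y r01 g0 s0 gs q0 gapq.
have q2 : 0 < 2 * q%:R :> R by rewrite mulr_gt0 ?ltr0n.
set nu := eq_angle q g s in h1 *; set L := (\sum_i _) / _ in h1.
apply: (le_trans (ler_distD L _ _)); apply: lerD h1.
rewrite /avglog /L -mulrBl -sumrB normrM normfV (gtr0_norm q2) ler_pdivrMr //.
apply: (le_trans (ler_norm_sum _ _ _)).
have -> : e * (2 * q%:R) = \sum_(i < q) (2 * e).
  by rewrite sumr_const card_ord -mulr_natr; ring.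
apply: ler_sum => i _; rewrite opprD addrACA (le_trans (ler_normD _ _)) //.
by rewrite mulr_natl mulr2n lerD.
Qed.

(** Passing from the unit circle to radius [1 - e1] adds at most [e1^2] to each factor [2 - 2 cos];
    the condition on [e1] keeps the resulting growth of the product within a factor [1 + e]. *)
Lemma sum_tlog_le n N (th : 'I_n -> R) (Z e e1 : R) x :
  (0 < n)%N -> 0 < Z -> 0 < e -> 0 < e1 < 1 -> e1 * (n%:R * 5 ^+ n) <= Z ^+ 2 * e ->
  (forall x, \prod_j (2 - 2 * cos (x - th j)) <= Z ^+ 2) ->
  (forall y, `|tlog N (1 - e1) y - logker (1 - e1) y| <= e) ->
  \sum_j tlog N (1 - e1) (x - th j) <= n%:R * (ln Z / n%:R + 2 * e).
Proof.
move=> n0 Z0 e0 /andP[e10 e11] e1W HZ HN; set rho := 1 - e1 in HN *.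
have nR : 0 < n%:R :> R by rewrite ltr0n.
have e12 : 0 < e1 ^+ 2 by rewrite exprn_gt0.
have e1e1 : e1 ^+ 2 <= e1 by rewrite expr2 ler_piMl ?ltW.
have rho01 : 0 <= rho < 1 by rewrite subr_ge0 (ltW e11) gtrBl.
have h1 : \sum_j tlog N rho (x - th j) <= \sum_j logker rho (x - th j) + n%:R * e.
  rewrite -sum_grid_const -big_split; apply: ler_sum => j _ /=.
  by have := HN (x - th j); rewrite ler_norml => /andP[_]; rewrite lerBlDl.
have w0 j : 0 < 1 - 2 * rho * cos (x - th j) + rho ^+ 2 by apply: logker_arg_gt0.
have h2 : \sum_j logker rho (x - th j) = ln (\prod_j (1 - 2 * rho * cos (x - th j) + rho ^+ 2)) / 2.
  rewrite /logker -mulr_suml; congr (_ / 2); rewrite -[LHS]expRK expR_sum; congr ln.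
  by apply: eq_bigr => j _; rewrite lnK // posrE.
have h3 : \prod_j (1 - 2 * rho * cos (x - th j) + rho ^+ 2) <= Z ^+ 2 * (1 + e).
  apply: (@le_trans _ _ (\prod_j (2 - 2 * cos (x - th j) + e1 ^+ 2))).
    apply: ler_prod => j _; rewrite (ltW (w0 j)) /= -subr_ge0.
    have -> : 2 - 2 * cos (x - th j) + e1 ^+ 2 - (1 - 2 * rho * cos (x - th j) + rho ^+ 2)
      = 2 * (e1 * (1 - cos (x - th j))) by rewrite /rho; ring.
    by rewrite mulr_ge0 // mulr_ge0 ?subr_ge0 ?cos_le1 // ltW.
  apply: (le_trans (prod_addl_le _ _ _ (ltW e12) _)) => [j|].
    rewrite subr_ge0; apply/andP; split; first by rewrite ler_piMr ?cos_le1.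
    by have := cos_geN1 (x - th j); clear; lra.
  have h4 : (4 + e1 ^+ 2) ^+ n <= 4 ^+ n + e1 ^+ 2 * (n%:R * 5 ^+ n).
    by apply: expr4D_le; rewrite (ltW e12) (le_trans e1e1) // ltW.
  have h5 : e1 ^+ 2 * (n%:R * 5 ^+ n) <= e1 * (n%:R * 5 ^+ n).
    by rewrite ler_wpM2r // mulr_ge0 ?exprn_ge0 // ltW.
  rewrite mulrDr mulr1; apply: lerD (HZ x) _; rewrite lerBlDl (le_trans h4) // lerD2l.
  exact: le_trans h5 e1W.
have h5 : ln (\prod_j (1 - 2 * rho * cos (x - th j) + rho ^+ 2)) <= 2 * ln Z + e.
  have e1p : 0 < 1 + e by rewrite addr_gt0.
  apply: (@le_trans _ _ (ln (Z ^+ 2 * (1 + e)))).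
    by rewrite ler_ln ?posrE ?mulr_gt0 ?prodr_gt0 // exprn_gt0.
  rewrite lnM ?posrE ?exprn_gt0 // lnXn // -(mulr_natl (ln Z)) lerD2l le_ln1Dx //.
  by rewrite (lt_trans _ e0) // ltrN10.
have -> : n%:R * (ln Z / n%:R + 2 * e) = ln Z + 2 * n%:R * e by field; rewrite gt_eqF.
have n1 : e <= n%:R * e by rewrite ler_peMl ?ler1n // ltW.
by move: h1 h5 n1 e0; rewrite h2; clear; lra.
Qed.

(** Both [d] and [(1 - e1) e1 / 2] are [e1 / 2] up to order [e1^2]. In the duality step this bounds
    the part of the kernel's mass lying away from the origin. *)
Lemma delta_bound (e1 e2 d : R) : 0 < e1 <= 1 / 4 -> e2 <= e1 ^+ 2 / 4 ->
  d = - ln (1 - e1) / 2 + 2 * e2 -> d - (1 - e1) * e1 / 2 <= 4 * e1 * d.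
Proof.
move=> /andP[e10 e14] e21 dE; set rho := 1 - e1 in dE *.
have rho0 : 0 < rho by rewrite /rho; lra.
have h : - ln rho <= e1 * (1 + 2 * e1).
  rewrite -lnV ?posrE //.
  have -> : rho^-1 = 1 + e1 / rho by rewrite /rho; field; rewrite gt_eqF.
  have er : 0 < e1 / rho by rewrite divr_gt0.
  apply: (@le_trans _ _ (e1 / rho)); first by apply: le_ln1Dx; lra.
  apply: ler_wpM2l; first exact: ltW.
  rewrite -div1r ler_pdivrMr // /rho.
  have : 0 <= e1 * (1 - 2 * e1) by apply: mulr_ge0; lra.
  lra.
have e13 : 0 <= e1 ^+ 3 by rewrite exprn_ge0 // ltW.
have d2 : 2 * d <= e1 + 3 * e1 ^+ 2 by rewrite dE; lra.
have : 2 * d * (1 - 4 * e1) <= (e1 + 3 * e1 ^+ 2) * (1 - 4 * e1).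
  by rewrite ler_wpM2r //; lra.
rewrite /rho; lra.
Qed.

(** The discretized equilibrium potential with [g = 1 / cosh t] enters the duality inequality: its
    peak is at least [t], its mean is [- ln g = ln cosh t] up to small errors, and [ln Z / n] bounds
    the mean potential of the roots. *)
Theorem arc_bound n (th : 'I_n -> R) (J : pred 'I_n) a b (Z t : R) :
  (0 < n)%N -> 0 < Z -> 0 < t ->
  (forall x, \prod_j (2 - 2 * cos (x - th j)) <= Z ^+ 2) ->
  0 <= a <= b -> (forall j, J j -> a <= th j <= b) ->
  0 <= #|J|%:R / n%:R - (b - a) / (2 * pi) ->
  (#|J|%:R / n%:R - (b - a) / (2 * pi)) * t <=
    ln ((expR t + expR (- t)) / 2) + ln Z / n%:R.
Proof.
move=> n0 Z0 t0 HZ ab Jab; set D := (_ - _) => D0.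
have nR : 0 < n%:R :> R by rewrite ltr0n.
(* All approximation errors are collected as multiples of an arbitrary [e]. *)
suff main e : 0 < e -> D * t <= ln ((expR t + expR (- t)) / 2) + ln Z / n%:R + 11 * e.
  apply/ler_addgt0Pr => e e0; have := main (e / 11).
  by rewrite divr_gt0 // (_ : 11 * (e / 11) = e) => [/(_ isT) //|]; field.
move=> e0.
(* This radius makes the term [ln r / 2] of the potential equal to [- e]. *)
pose r := expR (- (2 * e)).
have r01 : 0 < r < 1 by rewrite expR_gt0 expR_lt1 oppr_lt0 mulr_gt0.
have /andP[r0 r1] := r01.
have lnr : ln r / 2 = - e by rewrite expRK; field.
have := green_cosh r t r01 t0.
set g := 2 / _; set s := _ / (expR t + _) => -[g0 s0 gs tX].
pose X := green r g s.
have Xh := green_homo r g s r01 g0 s0 gs.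
have Xge0 := green_ge0 r g s r01 g0 s0 gs.
have gap1 := axis_gap_gt1 r g r01 g0.
have [q [q0 qe gapq]] : exists q, [/\ (0 < q)%N, q%:R^-1 <= e & 2 <= axis_gap r g ^+ q].
  have [||q1 H1] := expr_small (axis_gap r g)^-1 2^-1.
  - by rewrite invr_ge0 invf_lt1 //; lra.
  - by rewrite invr_gt0.
  exists (q1 + (Num.truncn e^-1).+1)%N; split; first by rewrite addnS.
    rewrite -[leRHS]invrK lef_pV2 ?posrE ?invr_gt0 ?ltr0n ?addnS //.
    by apply: ltW; apply: (lt_le_trans (truncnS_gt _)); rewrite ler_nat ltnS leq_addl.
  have := H1 _ (leq_addr (Num.truncn e^-1).+1 q1).
  by rewrite exprVn lef_pV2 ?posrE ?exprn_gt0 //; lra.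
pose C := ((1 - r) ^+ 2)^-1.
have C0 : 0 < C by rewrite invr_gt0 exprn_gt0 // subr_gt0.
pose W := n%:R * 5 ^+ n : R.
have W0 : 0 < W by rewrite mulr_gt0 ?exprn_gt0.
(* The three bounds serve [delta_bound], the concentration estimate [Cd], and the passage from the
   circle to radius [rho] in [sum_tlog_le]. *)
pose e1 := Num.min (1 / 4) (Num.min (e / (4 * C)) (Z ^+ 2 * e / W)).
have Z2 : 0 < Z ^+ 2 by rewrite exprn_gt0.
have e1p : 0 < e1.
  rewrite !lt_min; apply/and3P; split; apply: divr_gt0 => //; exact: mulr_gt0.
have e14 : e1 <= 1 / 4 by rewrite !ge_min lexx.
have e1C : 4 * C * e1 <= e.
  by rewrite mulrC -ler_pdivlMr ?mulr_gt0 // !ge_min lexx !orbT.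
have e1W : e1 * W <= Z ^+ 2 * e by rewrite -ler_pdivlMr // !ge_min lexx !orbT.
clearbody e1.
pose rho := 1 - e1.
have rho0 : 0 < rho by rewrite /rho; lra.
have rho1 : rho < 1 by rewrite /rho; lra.
have rho01 : 0 <= rho < 1 by rewrite (ltW rho0).
(* The truncation error must be of order [e1^2], since [d] itself is only of order [e1]. *)
pose e2 := Num.min e (e1 ^+ 2 / 4).
have e12 : 0 < e1 ^+ 2 by rewrite exprn_gt0.
have e2p : 0 < e2 by rewrite lt_min e0 divr_gt0.
have e2e : e2 <= e by rewrite ge_min lexx.
have e21 : e2 <= e1 ^+ 2 / 4 by rewrite ge_min lexx orbT.
clearbody e2.
have r01' : 0 <= r < 1 by rewrite (ltW r0).
have rr01 : 0 <= r * rho < 1 by rewrite mulr_ge0 ?ltW //= mulr_ilt1 ?ltW.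
have rhorho01 : 0 <= rho * rho < 1 by rewrite mulr_ge0 ?ltW //= mulr_ilt1 ?ltW.
have [N1 HN1] := tlog_logker_near r e2 r01' e2p.
have [N2 HN2] := tlog_logker_near (r * rho) e2 rr01 e2p.
have [N3 HN3] := tlog_logker_near rho e2 rho01 e2p.
have [N4 HN4] := tlog_logker_near (rho * rho) e2 rhorho01 e2p.
(* Beyond the four truncation thresholds, [N] makes the rounding loss [3 X 1] negligible on [2N+1]
   points. *)
pose N := (N1 + N2 + N3 + N4 + (Num.truncn (3 * X 1 / e)%R).+1)%N.
have [NN1 NN2 NN3 NN4] : [/\ (N1 <= N)%N, (N2 <= N)%N, (N3 <= N)%N & (N4 <= N)%N].
  by rewrite /N; clear; split; lia.
have N0 : (0 < N)%N by rewrite /N addnS.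
have {}HN1 := HN1 N NN1; have {}HN2 := HN2 N NN2.
have {}HN3 := HN3 N NN3; have {}HN4 := HN4 N NN4.
have X1t : t <= X 1 := tX.
have X1M : 3 * X 1 / N.*2.+1%:R <= e.
  rewrite ler_pdivrMr ?ltr0n // [leRHS]mulrC -ler_pdivrMr //.
  apply: ltW; apply: (lt_le_trans (truncnS_gt _)); rewrite ler_nat /N.
  by rewrite -muln2; move: (Num.truncn _) => k; clear; lia.
clearbody N.
pose M := N.*2.+1; have M0 : 0 < M%:R :> R by rewrite ltr0n.
pose nu := eq_angle q g s.
pose d := - ln rho / 2 + 2 * e2.
have rhop : 0 < rho < 1 by rewrite rho0.
have lnrho : ln rho <= 0 by rewrite ln_le0 // ltW.
have d0 : 0 < d by rewrite /d; move: lnrho e2p; clear; lra.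
have Hr y : tlog N r y - tlog N (r * rho) y <= d.
  have := HN1 y; have := HN2 y; rewrite !ler_norml => /andP[h1 h2] /andP[h3 h4].
  have := logkerB_le r rho y r01' rhop; move: h1 h2 h3 h4; rewrite /d; clear; lra.
have Hrho y : tlog N rho y - tlog N (rho * rho) y <= d.
  have := HN3 y; have := HN4 y; rewrite !ler_norml => /andP[h1 h2] /andP[h3 h4].
  have := logkerB_le rho rho y rho01 rhop; move: h1 h2 h3 h4; rewrite /d; clear; lra.
(* One [e] offsets [ln r / 2]; the other two absorb the error [e2 + 1/q], so the shifted potential
   lies between [X] and [X + 4 e]. *)
pose m1 := - ln g + 3 * e.
have chiX y : X (cos y) <= m1 + avglog q nu N r y <= X (cos y) + 4 * e.
  have := avglog_green q r g s N e2 y r01 g0 s0 gs q0 gapq HN1.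
  rewrite ler_norml lnr -/X -/nu => /andP[k1 k2].
  by move: k1 k2 qe e2e; rewrite /m1; clear; move=> *; apply/andP; split; lra.
have chi0 y : 0 <= m1 + avglog q nu N r y.
  by case/andP: (chiX y) => h _; apply: le_trans h; apply: Xge0; exact: cos_geN1.
have HH x : \sum_j tlog N rho (x - th j) <= n%:R * (ln Z / n%:R + 2 * e).
  apply: sum_tlog_le => // [|y]; first by rewrite e1p (le_lt_trans e14) // ltr_pdivrMr // mul1r ltr1n.
  exact: le_trans (HN3 y) e2e.
have := duality_max_translates q nu N n th J r rho d (ln Z / n%:R + 2 * e) m1
  q0 N0 r01' rho01 (ltW d0) Hr Hrho HH chi0.
rewrite -/C -/M; set S := \sum_(m < M) _ => hD.
have hS : S / M%:R <= (b - a) / (2 * pi) * X 1 + m1 + 5 * e.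
  rewrite ler_pdivrMr //.
  apply: (@le_trans _ _ (\sum_(m < M) (\big[Order.max/0]_(j | J j) X (cos (grid M m - th j)) + 4 * e))).
    apply: ler_sum => m _; apply: bigmax_le => [|j Jj].
      by rewrite addr_ge0 ?bigmax_ge_id // mulr_ge0 // ltW.
    case/andP: (chiX (grid M m - th j)) => _ h; apply: (le_trans h); rewrite lerD2r.
    exact: (le_bigmax_cond 0 (fun j => X (cos (grid M m - th j))) Jj).
  rewrite big_split /= sum_grid_const.
  have := sum_max_translates_le M n th J X a b isT Xh (Xge0 _ (lexx _)) ab Jab.
  (* [avglog] has mean zero on the grid, so the mean of [X] is at most [m1]. *)
  have : \sum_(m < M) X (cos (grid M m)) <= M%:R * m1.
    apply: (@le_trans _ _ (\sum_(m < M) (m1 + avglog q nu N r (grid M m - 0)))).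
      by apply: ler_sum => m _; case/andP: (chiX (grid M m)); rewrite subr0.
    by rewrite big_split /= sum_grid_const sum_avglog_grid addr0.
  have : 3 * X 1 <= e * M%:R by rewrite -ler_pdivrMr.
  by clear; lra.
have chi00 : X 1 <= m1 + avglog q nu N r 0 by case/andP: (chiX 0); rewrite cos0.
have rhod : d - rho * (1 - rho) / 2 <= 4 * e1 * d.
  by rewrite [1 - rho]subKr; apply: (delta_bound e1 e2); rewrite ?e1p.
have Cd : C * (d - rho * (1 - rho) / 2) <= e * d.
  apply: (@le_trans _ _ (C * (4 * e1 * d))); first by rewrite ler_wpM2l // ltW.
  have : 4 * C * e1 * d <= e * d by rewrite ler_wpM2r // ltW.
  by clear; lra.
have Kn : #|J|%:R <= n%:R :> R by rewrite ler_nat -[leqRHS]card_ord max_card.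
have K0 : 0 <= #|J|%:R :> R by [].
have hK : #|J|%:R * (X 1 - e) <= n%:R * (ln Z / n%:R + 2 * e + (b - a) / (2 * pi) * X 1 + m1 + 5 * e).
  rewrite -(ler_pM2l d0).
  apply: (@le_trans _ _ (#|J|%:R * (d * (m1 + avglog q nu N r 0) - C * (d - rho * (1 - rho) / 2)))).
    rewrite mulrCA ler_wpM2l //.
    have : d * X 1 <= d * (m1 + avglog q nu N r 0) by rewrite ler_wpM2l // ltW.
    by move: Cd; clear; lra.
  apply: (le_trans hD); rewrite [leRHS]mulrCA ler_wpM2l ?(ltW nR) //.
  rewrite -mulrA -mulrDr ler_wpM2l ?(ltW d0) //.
  by move: hS; clear; lra.
have DX : D * t <= D * X 1 by rewrite ler_wpM2l.
apply: (le_trans DX).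
have hKn : #|J|%:R / n%:R * (X 1 - e) <= ln Z / n%:R + 2 * e + (b - a) / (2 * pi) * X 1 + m1 + 5 * e.
  by rewrite mulrAC ler_pdivrMr // [leRHS]mulrC.
have Ke : #|J|%:R / n%:R * e <= e.
  by rewrite ler_piMl ?(ltW e0) // ler_pdivrMr // mul1r.
have -> : ln ((expR t + expR (- t)) / 2) = - ln g.
  by rewrite -lnV ?posrE // /g invf_div.
by move: hKn Ke; rewrite /D /m1; clear; lra.
Qed.

End ArcBound.

(** * The upper bound for polynomials *)

Section PolynomialRoots.
Context {R : realType}.
Implicit Types (x y t : R) (z w : R[i]) (f : {poly R[i]}).

(** The crude bound [cosh y <= 1 + y^2/2 exp y] is used at [y = t / 2^n] and carried up to [t] by
    [cosh(2y) = 2 cosh^2 y - 1 <= cosh^4 y]. This yields [exp(t^2/2 exp(t/2^n))], and [n] tends to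
    infinity. *)
Lemma cosh_le_expR_sqr t : 0 <= t -> (expR t + expR (- t)) / 2 <= expR (t ^+ 2 / 2).
Proof.
pose c x : R := (expR x + expR (- x)) / 2.
have expRV x : expR x * expR (- x) = 1 by rewrite -expRD subrr expR0.
have c1 x : 1 <= c x.
  rewrite /c; have := expRV x; have := expR_gt0 x; have := expR_gt0 (- x).
  move: (expR x) (expR (- x)) => u v *; have := sqr_ge0 (u - v); nra.
have cD x : c (x * 2) = 2 * c x ^+ 2 - 1.
  rewrite /c -mulNr !expRM_natr; have := expRV x.
  move: (expR x) (expR (- x)) => u v uv.
  have -> : 2 * ((u + v) / 2) ^+ 2 - 1 = (u ^+ 2 + v ^+ 2) / 2 + (u * v - 1) by field.
  by rewrite uv subrr addr0.
have small x : 0 <= x -> c x <= 1 + x ^+ 2 / 2 * expR x.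
  move=> x0; have -> : x = (x / 2) * 2 by rewrite divfK ?pnatr_eq0.
  set y := x / 2; have y0 : 0 <= y by rewrite divr_ge0.
  rewrite cD expRM_natr /c; have := expRV y; have := expR_gt0 y; have := expR_gt0 (- y).
  have := expR_ge1Dx (- (y * 2)); rewrite -mulNr expRM_natr.
  have := expR_ge1Dx y; have : expR (- y) <= 1 by rewrite expR_le1 oppr_le0.
  move: (expR y) (expR (- y)) => u v v1 u1 h v0 u0 uv.
  have h1 : u - v <= 2 * (y * u).
    have : u * (1 + - y * 2) <= u * v ^+ 2 by rewrite ler_wpM2l // ltW.
    have -> : u * v ^+ 2 = v by rewrite expr2 mulrA uv mul1r.
    lra.
  have h2 : (u - v) ^+ 2 <= (2 * (y * u)) ^+ 2 by rewrite lerXn2r ?nnegrE //; lra.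
  have -> : 2 * ((u + v) / 2) ^+ 2 - 1 = 2 * (u * v) - 1 + (u - v) ^+ 2 / 2 by field.
  rewrite uv; lra.
have doubling n x : 0 <= x -> c x <= expR (x ^+ 2 / 2 * expR (x / 2 ^+ n)).
  elim: n x => [|n IH] x x0.
    rewrite expr0 divr1; apply: (le_trans (small x x0)); exact: expR_ge1Dx.
  have x20 : 0 <= x / 2 by rewrite divr_ge0.
  have -> : c x = 2 * c (x / 2) ^+ 2 - 1 by rewrite -cD divfK ?pnatr_eq0.
  apply: (@le_trans _ _ (c (x / 2) ^+ 4)).
    have -> : c (x / 2) ^+ 4 = (c (x / 2) ^+ 2) ^+ 2 by rewrite -exprM.
    have := sqr_ge0 (c (x / 2) ^+ 2 - 1); lra.
  have -> : x ^+ 2 / 2 * expR (x / 2 ^+ n.+1) = ((x / 2) ^+ 2 / 2 * expR (x / 2 / 2 ^+ n)) * 4%:R.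
    have -> : x / 2 ^+ n.+1 = x / 2 / 2 ^+ n by rewrite exprS invfM mulrA.
    by field.
  rewrite expRM_natr lerXn2r ?nnegrE ?expR_ge0 //; last exact: IH.
  by apply: le_trans (c1 _).
move=> t0; rewrite -/(c t) -[leLHS]lnK ?posrE; last by apply: lt_le_trans (c1 t).
rewrite ler_expR.
have [->|tn0] := eqVneq t 0.
  have -> : c 0 = 1 by rewrite /c oppr0 expR0; field.
  by rewrite ln1 divr_ge0 ?sqr_ge0.
have t2 : 0 < t ^+ 2 / 2 by rewrite divr_gt0 // exprn_even_gt0.
apply/ler_addgt0Pr => e e0.
pose d := e / (t ^+ 2 / 2); have d0 : 0 < d by rewrite divr_gt0.
have l0 : 0 < ln (1 + d) by rewrite ln_gt0 // ltrDl.
have tp : 0 < t by rewrite lt_neqAle eq_sym tn0.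
have [||n H] := expr_small (2^-1 : R) (ln (1 + d) / t).
- by rewrite invr_ge0 invf_lt1 //=; lra.
- by rewrite divr_gt0.
have := doubling n t t0.
rewrite -[X in X <= _]lnK ?posrE; last by apply: lt_le_trans (c1 t).
rewrite ler_expR => /le_trans; apply.
have E : expR (t / 2 ^+ n) <= 1 + d.
  rewrite -[leRHS]lnK ?posrE; last by rewrite addr_gt0.
  rewrite ler_expR mulrC -ler_pdivlMr //.
  by have := H n (leqnn n); rewrite exprVn.
apply: (@le_trans _ _ (t ^+ 2 / 2 * (1 + d))); first by rewrite ler_wpM2l // ltW.
by rewrite mulrDr mulr1 lerD2l /d mulrC divfK // gt_eqF.
Qed.

Lemma cabsE z : cabs z = ComplexField.Normc.normc z.
Proof. by case: z. Qed.

Lemma cabsM z w : cabs (z * w) = cabs z * cabs w.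
Proof. by rewrite !cabsE ComplexField.Normc.normcM. Qed.

Lemma cabs_sqr z : cabs z ^+ 2 = nsq z.
Proof. by rewrite /cabs sqr_sqrtr // nsq_ge0. Qed.

Lemma cabs_ge0 z : 0 <= cabs z.
Proof. exact: sqrtr_ge0. Qed.

Lemma cabs_gt0 z : (0 < cabs z) = (z != 0).
Proof. by rewrite lt_neqAle cabs_ge0 andbT eq_sym -(nsq_eq0 z) -cabs_sqr sqrf_eq0. Qed.

Lemma e2piE t : e2pi t = cis (2 * pi * t).
Proof. by []. Qed.

Lemma polar z : exists t, z = (cabs z)%:C%C * e2pi t.
Proof.
have [->|z0] := eqVneq z 0.
  by exists 0; have -> : cabs (0 : R[i]) = 0 by [rewrite cabsE ComplexField.Normc.normc0]; rewrite mul0r.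
have c0 : 0 < cabs z by rewrite cabs_gt0.
have E := cabs_sqr z; move: E c0; case: z z0 => x y _; set c := cabs _; rewrite /nsq /= => E c0.
have xc : (x / c) ^+ 2 + (y / c) ^+ 2 = 1.
  by rewrite !expr_div_n -mulrDl -E divff // expf_neq0 // gt_eqF.
have x1 : -1 <= x / c <= 1.
  by rewrite -ler_norml -(expr_le1 (n := 2)) // real_normK ?num_real // -xc lerDl sqr_ge0.
have pn0 : 2 * pi != 0 :> R by rewrite mulf_neq0 ?pnatr_eq0 // gt_eqF // pi_gt0.
pose th := acos (x / c).
have cth : cos th = x / c by rewrite acosK // in_itv.
have sth : sin th = `|y / c|.
  rewrite sin_acos // -sqrtr_sqr; congr Num.sqrt; rewrite -xc; ring.
have [y0|y0] := leP 0 y.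
  exists (th / (2 * pi)); rewrite e2piE mulrC [_ * (th / _)]mulrC divfK // /cis cth sth.
  rewrite ger0_norm ?divr_ge0 ?(ltW c0) //.
  by apply/eqP; rewrite eq_complex /= !(mulr0, subr0, addr0, add0r) !divfK ?eqxx ?gt_eqF.
exists (- (th / (2 * pi))); rewrite e2piE mulrC mulrN [_ * (th / _)]mulrC divfK // /cis cosN sinN cth sth.
rewrite ltr0_norm ?opprK; last by rewrite ltr_pdivrMr // mul0r.
by apply/eqP; rewrite eq_complex /= !(mulr0, subr0, addr0, add0r) !divfK ?eqxx ?gt_eqF.
Qed.

Lemma polyrootsE f : f = lead_coef f *: \prod_(z <- polyroots f) ('X - z%:P).
Proof. exact: projT2 (closed_field_poly_normal f). Qed.

Lemma size_polyroots f : f != 0 -> size (polyroots f) = pdeg f.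
Proof.
move=> f0; rewrite /pdeg {2}(polyrootsE f) size_scale ?lead_coef_eq0 //.
by rewrite size_prod_XsubC.
Qed.

Lemma horner_polyroots f w :
  f.[w] = lead_coef f * \prod_(i < size (polyroots f)) (w - (polyroots f)`_i).
Proof.
rewrite {1}(polyrootsE f) hornerZ horner_prod (big_nth 0) big_mkord; congr (_ * _).
by apply: eq_bigr => i _; rewrite !hornerE.
Qed.

(** A supremum dominates the elements of a set bounded above; the sum of the moduli of the
    coefficients is such a bound. *)
Lemma supnorm_circle_ge f w : cabs w = 1 -> cabs f.[w] <= supnorm_circle f.
Proof.
move=> w1; apply: ub_le_sup; last by exists w.
exists (\sum_(i < size f) cabs f`_i) => _ [u [u1 ->]].
rewrite horner_coef; elim/big_ind2: _ => [|x x' y y' h h'|i _].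
- by rewrite cabsE ComplexField.Normc.normc0.
- by rewrite cabsE; apply: (le_trans (le_normcD _ _)); rewrite -!cabsE lerD.
- rewrite cabsM; have -> : cabs (u ^+ i) = 1; last by rewrite mulr1.
  by elim: (nat_of_ord i) => [|k IH]; rewrite ?expr0 ?cabsE ?ComplexField.Normc.normc1 // -cabsE exprS cabsM u1 IH mulr1.
Qed.

Lemma cabs_cis x : cabs (cis x) = 1.
Proof. by rewrite /cabs /= cos2Dsin2 sqrtr1. Qed.

(** A nonzero polynomial has fewer than [size f] roots, so it cannot vanish at all roots of unity of
    that order. *)
Lemma supnorm_circle_gt0 f : f != 0 -> 0 < supnorm_circle f.
Proof.
move=> f0; set q := size f.
have q0 : (0 < q)%N by rewrite size_poly_gt0.
have := @cis_prim_root R q q0; set e := cis _ => prim.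
have [i iq fi] : exists2 i, (i < q)%N & f.[e ^+ i] != 0.
  apply: contrapT => H.
  have : (size [seq e ^+ i | i <- iota 0 q] < size f)%N.
    apply: max_poly_roots => //.
      rewrite all_map; apply/allP => i; rewrite mem_iota add0n /= => iq; rewrite /root.
      by apply/negPn/negP => h; apply: H; exists i.
    rewrite map_inj_in_uniq ?iota_uniq // => i j; rewrite !mem_iota !add0n /= => iq jq /eqP.
    by rewrite (eq_prim_root_expr prim) !modn_small // => /eqP.
  by rewrite size_map size_iota ltnn.
apply: lt_le_trans (supnorm_circle_ge f (e ^+ i) _); first by rewrite cabs_gt0.
by rewrite cisX cabs_cis.
Qed.

End PolynomialRoots.

(** * Radial projection of the roots and the discrepancy inequality *)

Section Discrepancy.
Context {R : realType}.
Implicit Types (x y t : R) (z w : R[i]) (f : {poly R[i]}).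

(* Schur: moving a root radially to the unit circle decreases
   [|w - z|^2 / |z|] at every [w] of modulus one, as [|z| + 1/|z| >= 2]. *)
Lemma nsq_sub_radial x y (rho : R) : 0 <= rho ->
  rho * (2 - 2 * cos (x - y)) <= nsq (cis x - rho%:C%C * cis y).
Proof.
move=> rho0; rewrite /nsq /= !mul0r subr0 addr0 cosB.
have := cos2Dsin2 x; have := cos2Dsin2 y => hy hx.
have -> : (cos x - rho * cos y) ^+ 2 + (sin x - rho * sin y) ^+ 2 =
   (cos x ^+ 2 + sin x ^+ 2) + rho ^+ 2 * (cos y ^+ 2 + sin y ^+ 2)
    - 2 * rho * (cos x * cos y + sin x * sin y) by ring.
rewrite hx hy; have := sqr_ge0 (1 - rho); lra.
Qed.

(** Vieta gives [|a_0 a_n| = |a_n|^2 prod |z_j|], so the factors [|z_j|] lost in the radial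
    projection are exactly those in the normalization of the height. *)
Lemma prod_unit_roots_le f (th : 'I_(size (polyroots f)) -> R) x : f != 0 -> f`_0 != 0 ->
  (forall i : 'I_(size (polyroots f)), (polyroots f)`_i = (cabs (polyroots f)`_i)%:C%C * cis (th i)) ->
  \prod_i (2 - 2 * cos (x - th i)) <=
    (supnorm_circle f / Num.sqrt (cabs (f`_0 * lead_coef f))) ^+ 2.
Proof.
move=> f0 f00 thE; set rs := polyroots f in th thE *.
have l0 : lead_coef f != 0 by rewrite lead_coef_eq0.
have c0 : 0 < cabs (f`_0 * lead_coef f) by rewrite cabs_gt0 mulf_neq0.
rewrite expr_div_n sqr_sqrtr ?(ltW c0) // ler_pdivlMr //.
have nl : 0 < nsq (lead_coef f) by rewrite lt_neqAle nsq_ge0 eq_sym nsq_eq0 l0.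
have cE : cabs (f`_0 * lead_coef f) = nsq (lead_coef f) * \prod_(i < size rs) cabs rs`_i.
  rewrite cabsM -horner_coef0 horner_polyroots cabsM -/rs mulrAC -expr2 cabs_sqr; congr (_ * _).
  rewrite (big_morph (@cabs R) (@cabsM R) (_ : cabs 1 = 1)); last first.
    by rewrite cabsE ComplexField.Normc.normc1.
  by apply: eq_bigr => i _; rewrite sub0r /cabs; case: (rs`_i) => u v /=; rewrite !sqrrN.
apply: (@le_trans _ _ (nsq f.[cis x])); last first.
  rewrite -cabs_sqr lerXn2r ?nnegrE ?cabs_ge0 //; last by rewrite supnorm_circle_ge ?cabs_cis.
  by apply: ltW; exact: supnorm_circle_gt0.
rewrite cE horner_polyroots nsqM nsq_prod mulrCA ler_pM2l // mulrC -big_split.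
apply: ler_prod => i _ /=; apply/andP; split.
  by rewrite mulr_ge0 ?cabs_ge0 // subr_ge0; have := cos_le1 (x - th i); lra.
by rewrite [in leRHS]thE nsq_sub_radial // cabs_ge0.
Qed.

Lemma count_card (T : Type) (x0 : T) (s : seq T) (P : pred T) :
  count P s = #|[pred i : 'I_(size s) | P (nth x0 s i)]|.
Proof. by rewrite -sum1_count (big_nth x0) big_mkord sum1_card. Qed.

Lemma arc_excess_le f alpha beta t : (1 <= pdeg f)%N -> f`_0 != 0 ->
  alpha <= beta -> 0 < t ->
  0 <= (Nroots f alpha beta)%:R / (pdeg f)%:R - (beta - alpha) ->
  ((Nroots f alpha beta)%:R / (pdeg f)%:R - (beta - alpha)) * t <= t ^+ 2 / 2 + height f.
Proof.
move=> n1 f00 ab t0.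
have f0 : f != 0 by apply: contra_neq f00 => ->; rewrite coef0.
have sz := size_polyroots f f0.
pose n := size (polyroots f).
have n0 : (0 < n)%N by rewrite /n sz.
pose J : pred 'I_n := fun i => `[< arg_in_arc alpha beta (polyroots f)`_i >].
(* [k] whole turns move the arc to nonnegative angles, as [arc_bound] requires. *)
pose k := (Num.truncn `|alpha|).+1.
have ak : 0 <= alpha + k%:R.
  have := truncnS_gt `|alpha|; rewrite -/k; have := ler_norm (- alpha); rewrite normrN; lra.
(* A root counted by [J] gets an argument inside the shifted arc; any polar argument serves for the
   others. *)
have [th thE] : exists th : 'I_n -> R, forall i : 'I_n,
    (polyroots f)`_i = (cabs (polyroots f)`_i)%:C%C * cis (th i) /\
    (J i -> 2 * pi * (alpha + k%:R) <= th i <= 2 * pi * (beta + k%:R)).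
  suff /choice[th thE] : forall i : 'I_n, exists y, (polyroots f)`_i = (cabs (polyroots f)`_i)%:C%C * cis y /\
      (J i -> 2 * pi * (alpha + k%:R) <= y <= 2 * pi * (beta + k%:R)) by exists th.
  move=> i.
  case: (boolP (J i)) => [/asboolP[u [/andP[au ub] uE]]|nJ].
    exists (2 * pi * (u + k%:R)); split.
      rewrite {1}uE e2piE; congr (_ * _); rewrite /cis.
      have -> : 2 * pi * (u + k%:R) = 2 * pi * u + 2 * pi * k%:R by ring.
      by rewrite cosD2pin sinD2pin.
    by move=> _; rewrite !ler_pM2l ?mulr_gt0 ?pi_gt0 // !lerD2r au.
  have [u uE] := polar (polyroots f)`_i.
  by exists (2 * pi * u); split => //; rewrite (negbTE nJ).
have p0 : 2 * pi != 0 :> R by rewrite mulf_neq0 ?pnatr_eq0 // gt_eqF // pi_gt0.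
have pp : 0 < 2 * pi :> R by rewrite mulr_gt0 // pi_gt0.
have NE : Nroots f alpha beta = #|J|.
  by rewrite /Nroots (count_card _ 0).
have lE : (2 * pi * (beta + k%:R) - 2 * pi * (alpha + k%:R)) / (2 * pi) = beta - alpha.
  by rewrite -mulrBr [2 * pi * _]mulrC mulfK //; ring.
set Z := supnorm_circle f / Num.sqrt (cabs (f`_0 * lead_coef f)).
have Z0 : 0 < Z.
  rewrite divr_gt0 ?supnorm_circle_gt0 // sqrtr_gt0 cabs_gt0 mulf_neq0 //.
  by rewrite lead_coef_eq0.
rewrite NE -sz -/n -lE => D0.
have /= H := arc_bound n th J (2 * pi * (alpha + k%:R)) (2 * pi * (beta + k%:R)) Z t n0 Z0 t0.
apply: le_trans (H _ _ _ D0) _.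
- by move=> x; apply: prod_unit_roots_le => // i; case: (thE i).
- by rewrite mulr_ge0 ?(ltW pp) //= ler_pM2l // lerD2r.
- by move=> j Jj; case: (thE j) => _; apply.
apply: lerD; last by rewrite /height -sz mulrC.
have c0 : 0 < (expR t + expR (- t)) / 2 by rewrite divr_gt0 // addr_gt0 ?expR_gt0.
by rewrite -[leRHS]expRK ler_ln ?posrE ?expR_gt0 // cosh_le_expR_sqr // ltW.
Qed.

Lemma discrepancy_le f : (1 <= pdeg f)%N -> f`_0 != 0 ->
  discrepancy f <= Num.sqrt 2 * Num.sqrt (height f).
Proof.
move=> n1 f00; set B := _ * _.
have B0 : 0 <= B by rewrite mulr_ge0 ?sqrtr_ge0.
have B2 : 2 * height f <= B ^+ 2.
  rewrite exprMn sqr_sqrtr // ler_pM2l //.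
  (* For a negative height the left side is negative and the square is not. *)
  case: (leP 0 (height f)) => h; first by rewrite sqr_sqrtr.
  by apply: le_trans (ltW h) (sqr_ge0 _).
apply: ge_sup.
  exists ((Nroots f 0 0)%:R / (pdeg f)%:R - (0 - 0)), 0, 0; split => //; lra.
move=> _ [alpha [beta [ab _ ->]]]; set x := _ - _.
case: (leP x 0) => x0; first exact: le_trans x0 B0.
(* With [t] equal to the excess [x] itself the bound reads [x^2 <= x^2 / 2 + height f]. *)
have := arc_excess_le f alpha beta x n1 f00 ab x0 (ltW x0); rewrite -/x => h.
by rewrite -ler_sqr ?nnegrE ?(ltW x0) //; lra.
Qed.

End Discrepancy.

(** * Sharpness *)

Section AltSum.
Context {R : realType}.
Implicit Types (p q : {poly R}) (m k : nat).

(** The [m]-th finite difference of [f] at [0], up to the sign [(-1)^m]. *)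
Definition altsum m (f : nat -> R) : R := \sum_(i < m.+1) (-1) ^+ i * 'C(m, i)%:R * f i.

Lemma altsumS m f : altsum m.+1 f = altsum m (fun i => f i - f i.+1).
Proof.
rewrite /altsum big_ord_recl /= bin0.
under eq_bigr do rewrite /bump /= add1n binS natrD mulrDr mulrDl.
rewrite big_split /= [X in _ + (X + _)]big_ord_recr /= bin_small // mulr0 mul0r addr0.
under [RHS]eq_bigr do rewrite mulrBr.
rewrite sumrB [X in _ = X - _]big_ord_recl /= bin0 addrA; congr (_ + _).
by rewrite -sumrN; apply: eq_bigr => i _; rewrite exprS; ring.
Qed.

Lemma altsumZ m (a : R) f : altsum m (fun i => a * f i) = a * altsum m f.
Proof. by rewrite /altsum mulr_sumr; apply: eq_bigr => i _; ring. Qed.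

Lemma altsumD m f g : altsum m (fun i => f i + g i) = altsum m f + altsum m g.
Proof. by rewrite /altsum -big_split; apply: eq_bigr => i _ /=; ring. Qed.

Lemma eq_altsum m f g : (forall i, (i <= m)%N -> f i = g i) -> altsum m f = altsum m g.
Proof. by move=> fg; apply: eq_bigr => i _; rewrite fg // -ltnS. Qed.

Lemma size_diff_poly m p : (size p <= m.+1)%N -> (size (p - (p \Po ('X + 1)))%R <= m)%N.
Proof.
elim: m p => [|m IH] p sp.
  by rewrite (size1_polyC sp) comp_polyC subrr size_poly0.
have [q [c pE]] : exists q c, p = q * 'X + c%:P.
  by elim/poly_ind: p {sp} => [|q c _]; [exists 0, 0; rewrite mul0r addr0 | exists q, c].
have sq : (size q <= m.+1)%N.
  move: sp; rewrite pE size_MXaddC; case: ifP => // /andP[/eqP -> _] _.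
  by rewrite size_poly0.
have -> : p - (p \Po ('X + 1))%R = (q - (q \Po ('X + 1))) * 'X - (q \Po ('X + 1)).
  by rewrite pE rmorphD rmorphM /= comp_polyX comp_polyC; ring.
apply: (leq_trans (size_polyD _ _)); rewrite geq_max size_polyN; apply/andP; split.
  by apply: (leq_trans (size_polyMleq _ _)); rewrite size_polyX addn2 /= ltnS IH.
by rewrite size_comp_poly2 // size_XaddC.
Qed.

(** Each difference lowers the degree by one, so [m] of them annihilate degree below [m]. *)
Lemma altsum_poly m p : (size p <= m)%N -> altsum m (fun i => p.[i%:R]) = 0.
Proof.
elim: m p => [|m IH] p sp.
  have -> : p = 0 by apply/eqP; rewrite -size_poly_eq0 -leqn0.
  by rewrite /altsum big1 // => i _; rewrite horner0 mulr0.
rewrite altsumS -(IH (p - (p \Po ('X + 1))%R)) ?size_diff_poly //.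
by apply: eq_altsum => i _; rewrite hornerD hornerN horner_comp !hornerE natr1.
Qed.

(** The value is the Beta integral of [x^k (1 - x)^m] over [[0, 1]]; the induction uses differences
    only. *)
Lemma altsum_inv m k :
  altsum m (fun i => (k.+1 + i)%:R^-1) = m`!%:R * k`!%:R / (m + k.+1)`!%:R.
Proof.
elim: m k => [|m IH] k.
  have k0 : k`!%:R != 0 :> R by rewrite pnatr_eq0 -lt0n fact_gt0.
  have kn0 : k.+1%:R != 0 :> R by rewrite pnatr_eq0.
  rewrite /altsum big_ord1 /= bin0 !mul1r addn0 add0n factS natrM.
  by rewrite invfM mulrCA divff ?mulr1.
rewrite altsumS.
transitivity (altsum m (fun i => (k.+1 + i)%:R^-1) + (-1) * altsum m (fun i => (k.+2 + i)%:R^-1)).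
  by rewrite -altsumZ -altsumD; apply: eq_altsum => i _; rewrite addnS addSn mulN1r.
rewrite !IH !addSn !addnS [(m + k).+2`!]factS [m.+1`!]factS [k.+1`!]factS.
have h1 : (m + k).+1`!%:R != 0 :> R by rewrite pnatr_eq0 -lt0n fact_gt0.
have h2 : (m + k).+2%:R != 0 :> R by rewrite pnatr_eq0.
have E : (m + k).+2%:R = m.+1%:R + k.+1%:R :> R by rewrite -natrD addSn addnS.
move: h1; move: ((m + k).+1`!) (m`!) (k`!) => X Y W h1.
rewrite !natrM; move: h2; rewrite E; move: (m.+1%:R : R) (k.+1%:R : R) => a b h2.
by field; rewrite h1 h2.
Qed.

(** Division by [X + k + 1] leaves the remainder [p(-k-1)] and a quotient of degree below [m], which
    the difference annihilates. *)
Lemma altsum_inv_poly m k p : (size p <= m.+1)%N ->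
  altsum m (fun i => p.[i%:R] / (k.+1 + i)%:R) =
  p.[- k.+1%:R] * (m`!%:R * k`!%:R / (m + k.+1)`!%:R).
Proof.
move=> sp.
have : root (p - p.[- k.+1%:R]%:P) (- k.+1%:R) by rewrite /root !hornerE subrr.
case/factor_theorem => q qE.
have sq : (size q <= m)%N.
  have [->|qn0] := eqVneq q 0; first by rewrite size_poly0.
  have : (size (p - p.[- k.+1%:R]%:P)%R <= m.+1)%N.
    apply: (leq_trans (size_polyD _ _)); rewrite geq_max sp size_polyN.
    exact: leq_trans (size_polyC_leq1 _) _.
  by rewrite qE size_Mmonic ?monicXsubC // size_XsubC addn2.
rewrite -altsum_inv -altsumZ -[RHS]addr0 -(altsum_poly m q sq) -altsumD.
apply: eq_altsum => i _.
have kn0 : (k.+1 + i)%:R != 0 :> R by rewrite pnatr_eq0.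
have -> : p.[i%:R] = p.[- k.+1%:R] + q.[i%:R] * (k.+1 + i)%:R.
  have := f_equal (fun r => r.[i%:R]) qE; rewrite !hornerE => h.
  by rewrite -[LHS](subrK p.[- k.+1%:R]) h natrD; ring.
by rewrite mulrDl mulfK.
Qed.

Lemma size_prod_lin n (P : nat -> {poly R}) : (forall i, (size (P i) <= 2)%N) ->
  (size (\prod_(i < n) P i)%R <= n.+1)%N.
Proof.
move=> h; elim: n => [|n IH]; first by rewrite big_ord0 size_poly1.
rewrite big_ord_recr /=; apply: (leq_trans (size_polyMleq _ _)).
by have := leq_add IH (h n); case: (_ + _)%N => [|a] //; rewrite addn2 ltnS.
Qed.

Lemma ffact_real n j : (n ^_ j)%:R = \prod_(s < j) (n%:R - s%:R) :> R.
Proof.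
elim: j => [|j IH]; first by rewrite big_ord0.
rewrite big_ord_recr /= ffactnSr natrM IH.
case: (leqP j n) => jn; first by rewrite natrB.
by rewrite -IH ffact_small // !mul0r.
Qed.

End AltSum.

(** * The extremal polynomial and its norm *)

Section ExtremalPoly.
Context {R : realType}.
Implicit Types (k l m : nat).

Lemma coef_1subXn k j : ((1 - 'X : {poly R}) ^+ k)`_j = (-1) ^+ j * 'C(k, j)%:R.
Proof.
elim: k j => [|k IH] j.
  by rewrite expr0 coef1; case: j => [|j]; rewrite /= ?bin0n ?mul1r ?mulr0.
rewrite exprS mulrBl mul1r coefB coefXM !IH; case: j => [|j] /=; first by rewrite !bin0 subr0.
by rewrite binS natrD exprS; ring.
Qed.

Lemma sum_ord_trunc M N (f : nat -> R) : (M <= N)%N ->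
  (forall i, (M <= i < N)%N -> f i = 0) -> \sum_(i < N) f i = \sum_(i < M) f i.
Proof.
move=> MN f0; rewrite -(big_mkord xpredT f) (@big_cat_nat _ _ _ M) //= big_mkord.
by rewrite [X in _ + X]big_nat [X in _ + X]big1 ?addr0 // => i /f0.
Qed.

Variables kp m : nat.
Let k := kp.+1.
Let n := (m + k)%N.

(* The reversed Szego polynomial of degree [m] for the weight [|1 - z|^(2 k)]. *)
Definition szego_coef i : R :=
  'C(m, i)%:R * ((kp + i)`!%:R * (n - i)`!%:R) / (kp`!%:R * n`!%:R).

Definition szego : {poly R} := \poly_(i < m.+1) szego_coef i.

Definition ext_poly : {poly R} := (1 - 'X) ^+ k * szego.

Let a j : R := ((1 - 'X : {poly R}) ^+ k)`_j.

(** Coefficient of [z^j] in [z^l (1 - z)^k]. For [0 <= l <= m] these polynomials span the multiples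
    of [(1 - z)^k] of degree at most [n]. *)
Let shifted l j : R := if (l <= j)%N then a (j - l) else 0.

Lemma coef_ext_poly j : (j <= n)%N ->
  ext_poly`_j = \sum_(l < m.+1) szego_coef l * shifted l j.
Proof.
move=> jn; rewrite /ext_poly coefMr.
rewrite (eq_bigr (fun l : 'I_j.+1 => szego`_l * shifted l j)); last first.
  by move=> l _; rewrite /shifted -ltnS ltn_ord mulrC.
transitivity (\sum_(l < n.+1) szego`_l * shifted l j).
  rewrite [RHS](@sum_ord_trunc j.+1 n.+1 (fun l => szego`_l * shifted l j)) // => l /andP[jl _].
  by rewrite /shifted leqNgt jl mulr0.
rewrite (@sum_ord_trunc m.+1 n.+1 (fun l => szego`_l * shifted l j)).
- by apply: eq_bigr => l _; rewrite coef_poly ltn_ord.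
- by rewrite ltnS leq_addr.
- by move=> l /andP[ml _]; rewrite coef_poly ltnNge ml mul0r.
Qed.

(** Reversing the coefficients of [(1 - z)^k] multiplies it by [(-1)^k], so the inner product
    becomes one coefficient of a product. *)
Lemma inner_reflect l : (l <= m)%N ->
  \sum_(j < n.+1) ext_poly`_j * shifted l j = (-1) ^+ k * (ext_poly * (1 - 'X) ^+ k)`_(k + l).
Proof.
move=> lm; have kln : ((k + l).+1 <= n.+1)%N by rewrite ltnS /n addnC leq_add2r.
rewrite (@sum_ord_trunc (k + l).+1 n.+1 (fun j => ext_poly`_j * shifted l j)) //; last first.
  move=> j /andP[klj _]; rewrite /shifted; case: ifP => lj; last by rewrite mulr0.
  by rewrite /a coef_1subXn bin_small; [rewrite !mulr0 | rewrite ltn_subRL addnC].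
rewrite coefM mulr_sumr; apply: eq_bigr => j _.
rewrite mulrCA; congr (_ * _); rewrite /shifted /a !coef_1subXn.
have := ltn_ord j; rewrite ltnS => jkl.
case: (leqP l j) => lj; last first.
  by rewrite bin_small; [rewrite !mulr0 | rewrite ltn_subRL addnC ltn_add2l].
have -> : (k + l - j)%N = (k - (j - l))%N by rewrite subnBA.
have jk : (j - l <= k)%N by rewrite leq_subLR [(l + k)%N]addnC.
move: (j - l)%N jk => i ik; rewrite bin_sub // mulrA -exprD; congr (_ * _).
rewrite -signr_odd -[RHS]signr_odd oddD oddB //; by case: (odd k); case: (odd i).
Qed.

Lemma inner_altsum l : (l <= m)%N ->
  \sum_(j < n.+1) ext_poly`_j * shifted l j =
  (-1) ^+ l / (kp`!%:R * n`!%:R) *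
  altsum m (fun i => (i <= k + l)%:R * 'C(k + k, k + l - i)%:R * ((kp + i)`!%:R * (n - i)`!%:R)).
Proof.
move=> lm; rewrite inner_reflect // /ext_poly mulrAC -exprD coefMr.
pose t i := (-1) ^+ (k + l - i) * 'C(k + k, k + l - i)%:R * szego`_i.
rewrite (eq_bigr (fun i : 'I_(k + l).+1 => (i <= k + l)%:R * t i)); last first.
  by move=> i _; rewrite -ltnS ltn_ord mul1r coef_1subXn.
pose g i := (i <= k + l)%:R * t i.
have kln : ((k + l).+1 <= n.+1)%N by rewrite ltnS /n addnC leq_add2r.
rewrite -/(g _) -(@sum_ord_trunc (k + l).+1 n.+1 g) //; last first.
  by move=> i /andP[kli _]; rewrite /g leqNgt kli mul0r.
rewrite (@sum_ord_trunc m.+1 n.+1 g); [|by rewrite ltnS leq_addr|]; last first.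
  by move=> i /andP[mi _]; rewrite /g /t coef_poly ltnNge mi !mulr0.
rewrite /altsum !mulr_sumr; apply: eq_bigr => i _.
rewrite /g /t coef_poly ltn_ord /szego_coef.
case: leqP => ikl; last by rewrite !(mul0r, mulr0).
have sgn : (-1) ^+ k * (-1) ^+ (k + l - i) = (-1) ^+ l * (-1) ^+ i :> R.
  rewrite -!exprD -signr_odd -[RHS]signr_odd oddD oddB // !oddD.
  by case: (odd k); case: (odd l); case: (odd i).
rewrite !mul1r !mulrA sgn; ring.
Qed.

Lemma fact_unit j : j`!%:R != 0 :> R.
Proof. by rewrite pnatr_eq0 -lt0n fact_gt0. Qed.

(** The binomial and the factorials collapse to two falling factorials, polynomials in [i] of total
    degree [(l - 1) + (m - l) = m - 1]; outside the range of the binomial both sides vanish. *)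
Lemma inner_pos l i : (0 < l <= m)%N -> (i <= m)%N ->
  ((i <= k + l) * 'C(k + k, k + l - i) * ((kp + i)`! * (n - i)`!) =
   (k + k)`! * ((kp + i) ^_ (l.-1) * (n - i) ^_ (m - l)))%N.
Proof.
case: l => // l /= lm im.
have n_i : (n - i = m + k - i)%N by [].
case: (leqP i (k + l.+1)) => ikl; last first.
  by rewrite !mul0n [X in (_ * (_ * X))%N]ffact_small ?muln0 //; rewrite /n; lia.
rewrite mul1n.
case: (leqP l (kp + i)) => lki; last first.
  rewrite bin_small ?mul0n; last by rewrite /k; lia.
  by rewrite [X in (_ * (X * _))%N]ffact_small ?mul0n ?muln0.
have h1 : ((kp + i) ^_ l * (k + k - (k + l.+1 - i))`! = (kp + i)`!)%N.
  rewrite -(ffact_fact lki); congr (_ * _`!)%N; rewrite /k; lia.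
have h2 : ((n - i) ^_ (m - l.+1) * (k + l.+1 - i)`! = (n - i)`!)%N.
  have mln : (m - l.+1 <= n - i)%N by rewrite /n; lia.
  rewrite -(ffact_fact mln); congr (_ * _`!)%N; rewrite /n; lia.
have le : (k + l.+1 - i <= k + k)%N by rewrite /k; lia.
rewrite -h1 -h2 -(bin_fact le).
by rewrite !mulnA; lia.
Qed.

(** For [l = 0] the same cancellation leaves a polynomial of degree [m] divided by [k + i]. *)
Lemma inner_zero i : (i <= m)%N ->
  ((i <= k + 0) * 'C(k + k, k + 0 - i) * ((kp + i)`! * (n - i)`!) * (k + i) =
   (k + k)`! * (n - i) ^_ m)%N.
Proof.
move=> im; rewrite addn0.
case: (leqP i k) => ik; last first.
  by rewrite !mul0n ffact_small ?muln0 //; rewrite /n; lia.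
have h2 : ((n - i) ^_ m * (k - i)`! = (n - i)`!)%N.
  have mln : (m <= n - i)%N by rewrite /n; lia.
  rewrite -(ffact_fact mln); congr (_ * _`!)%N; rewrite /n; lia.
have h1 : ((k + i) * (kp + i)`! = (k + k - (k - i))`!)%N.
  rewrite {1}/k addSn -factS; congr (_`!); move: ik; rewrite /k; lia.
have le : (k - i <= k + k)%N by lia.
rewrite mul1n -h2 -(bin_fact le) -h1; lia.
Qed.

Lemma inner_orth l : (0 < l <= m)%N -> \sum_(j < n.+1) ext_poly`_j * shifted l j = 0.
Proof.
move=> lm; have /andP[l0 l1] := lm; rewrite inner_altsum //.
pose p : {poly R} := (k + k)`!%:R *: ((\prod_(s < l.-1) ('X + (kp%:R - s%:R)%:P)) *
  \prod_(s < m - l) ((n%:R - s%:R)%:P - 'X)).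
suff -> : altsum m (fun i => (i <= k + l)%:R * 'C(k + k, k + l - i)%:R * ((kp + i)`!%:R * (n - i)`!%:R))
   = altsum m (fun i => p.[i%:R]).
  rewrite altsum_poly ?mulr0 //; apply: (leq_trans (size_scale_leq _ _)).
  apply: (leq_trans (size_polyMleq _ _)).
  have h1 := @size_prod_lin R l.-1 (fun s => 'X + (kp%:R - s%:R)%:P) (fun s => _).
  have h2 := @size_prod_lin R (m - l) (fun s => (n%:R - s%:R)%:P - 'X) (fun s => _).
  have {}h1 := h1 (fun s => ltac:(by rewrite size_XaddC)).
  have {}h2 := h2 (fun s => ltac:(by rewrite -opprB size_polyN size_XsubC)).
  have := leq_add h1 h2; case: (_ + _)%N => [|b] //= h.
  by rewrite -ltnS; apply: (leq_trans h); rewrite prednK // addnS subnKC.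
apply: eq_altsum => i im.
rewrite -!natrM inner_pos // /p; move: ((k + k)`!) => X; rewrite !natrM !ffact_real hornerZ hornerM !horner_prod.
congr (_ * (_ * _)); apply: eq_bigr => s _; rewrite !hornerE.
  by rewrite natrD /=; ring.
by rewrite natrB /=; [ring | rewrite /n; lia].
Qed.

(** The difference of a degree [m] polynomial over [k + i] is read off from its value at [- k], here
    [(m + 2k)!]. *)
Lemma inner_norm : \sum_(j < n.+1) ext_poly`_j * shifted 0 j =
  m`!%:R * (m + k + k)`!%:R / n`!%:R ^+ 2.
Proof.
rewrite inner_altsum // expr0.
pose p : {poly R} := (k + k)`!%:R *: \prod_(s < m) ((n%:R - s%:R)%:P - 'X).
have -> : altsum m (fun i => (i <= k + 0)%:R * 'C(k + k, k + 0 - i)%:R * ((kp + i)`!%:R * (n - i)`!%:R))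
   = altsum m (fun i => p.[i%:R] / (kp.+1 + i)%:R).
  apply: eq_altsum => i im.
  have kn0 : (k + i)%:R != 0 :> R by rewrite pnatr_eq0.
  apply: (mulIf kn0); rewrite divfK // -!natrM inner_zero // natrM ffact_real /p hornerZ horner_prod.
  congr (_ * _); apply: eq_bigr => s _; rewrite !hornerE.
  by rewrite natrB; [ring | rewrite /n; lia].
have sp : (size (\prod_(s < m) ((n%:R - s%:R)%:P - 'X : {poly R}))%R <= m.+1)%N.
  apply: (@size_prod_lin R m (fun s => (n%:R - s%:R)%:P - 'X)) => s.
  by rewrite -opprB size_polyN size_XsubC.
rewrite altsum_inv_poly; last exact: leq_trans (size_scale_leq _ _) sp.
have -> : p.[- kp.+1%:R] = (m + k + k)`!%:R.
  have mk : (m <= n + k)%N by rewrite /n; lia.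
  rewrite /p hornerZ horner_prod -[in RHS]/(n + k)%N -(ffact_fact mk) mulnC natrM ffact_real.
  congr (_ * _); first by congr (_`!%:R); rewrite /n; lia.
  by apply: eq_bigr => s _; rewrite !hornerE natrD /k /=; ring.
rewrite -/k -/n; have := fact_unit n; have := fact_unit kp.
move: (n`!%:R : R) (kp`!%:R : R) (m`!%:R : R) ((m + k + k)`!%:R : R) => x y z w y0 x0.
by field; rewrite x0 y0.
Qed.

Lemma szego_coef0 : szego_coef 0 = 1.
Proof.
by rewrite /szego_coef bin0 mul1r addn0 subn0 divff // mulf_neq0 ?fact_unit.
Qed.

Lemma szego_coefm : szego_coef m = k%:R / n%:R.
Proof.
rewrite /szego_coef binn mul1r.
have -> : (n - m = kp.+1)%N by rewrite /n addKn.
have nE : n = (kp + m).+1 by rewrite /n /k addnS addnC.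
rewrite nE !factS !natrM -/k; have h1 := fact_unit (kp + m); have h2 := fact_unit kp.
have h3 : (kp + m).+1%:R != 0 :> R by rewrite pnatr_eq0.
move: h1 h2 h3; move: ((kp + m)`!%:R : R) (kp`!%:R : R) ((kp + m).+1%:R : R) (k%:R : R) => x y z w x0 y0 z0.
by field; rewrite x0 y0 z0.
Qed.

(** Expanding one factor in the shifts of [(1 - z)^k], orthogonality leaves only the shift [l = 0],
    whose coefficient is [1]. *)
Lemma sum_sqr_ext_poly : \sum_(j < n.+1) ext_poly`_j ^+ 2 =
  m`!%:R * (m + k + k)`!%:R / n`!%:R ^+ 2.
Proof.
transitivity (\sum_(j < n.+1) \sum_(l < m.+1) szego_coef l * (ext_poly`_j * shifted l j)).
  apply: eq_bigr => j _; rewrite expr2 {1}coef_ext_poly; last by rewrite -ltnS.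
  by rewrite mulr_suml; apply: eq_bigr => l _; ring.
rewrite exchange_big big_ord_recl /= [X in _ + X]big1 => [|l _].
  by rewrite addr0 -mulr_sumr szego_coef0 mul1r inner_norm.
by rewrite -mulr_sumr inner_orth ?mulr0 // /bump add1n /= ltn_ord.
Qed.

(** The quotient of factorials is the product over [1 <= j <= k] of [(m + k + j) / (m + j)], each at
    most [1 + k/m]. *)
Lemma sum_sqr_ext_poly_le : (0 < m)%N ->
  \sum_(j < n.+1) ext_poly`_j ^+ 2 <= (1 + k%:R / m%:R) ^+ k.
Proof.
move=> m0; rewrite sum_sqr_ext_poly.
have mR : 0 < m%:R :> R by rewrite ltr0n.
have fp j : 0 < j`!%:R :> R by rewrite ltr0n fact_gt0.
suff H j : (m + k + j)`!%:R * m`!%:R <= (1 + k%:R / m%:R) ^+ j * ((m + k)`!%:R * (m + j)`!%:R) :> R.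
  by rewrite ler_pdivrMr ?exprn_gt0 // mulrC expr2 H.
elim: j => [|j IH]; first by rewrite !addn0 expr0 mul1r.
have e1 : (m + k + j.+1)`!%:R = (m + k + j).+1%:R * (m + k + j)`!%:R :> R by rewrite addnS factS natrM.
have e2 : (m + j.+1)`!%:R = (m + j).+1%:R * (m + j)`!%:R :> R by rewrite addnS factS natrM.
rewrite e1 e2 exprS.
set u := (m + k + j)`!%:R in IH *; set v := m`!%:R in IH *.
set w := (m + k)`!%:R in IH *; set x := (m + j)`!%:R in IH *.
set y := (1 + k%:R / m%:R) in IH *.
have h : (m + k + j).+1%:R <= y * (m + j).+1%:R.
  rewrite /y mulrDl mul1r -mulrA -[(m + k + j).+1]/((m + k + j).+1)%N.
  have -> : (m + k + j).+1%:R = (m + j).+1%:R + k%:R :> R by rewrite -natrD; congr (_%:R); lia.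
  rewrite lerD2l -[leLHS]mulr1 ler_wpM2l // mulrC ler_pdivlMr // mul1r ler_nat; lia.
have y0 : 0 <= y by rewrite addr_ge0 ?divr_ge0.
have -> : (m + k + j).+1%:R * u * v = (m + k + j).+1%:R * (u * v) by ring.
have -> : y * y ^+ j * (w * ((m + j).+1%:R * x)) = (y * (m + j).+1%:R) * (y ^+ j * (w * x)) by ring.
by apply: ler_pM => //; rewrite ?mulr_ge0 ?ler0n.
Qed.

Lemma ext_polyE : ext_poly = (-1) ^+ k *: (('X - 1%:P) ^+ k * szego).
Proof.
rewrite scalerAl /ext_poly; congr (_ * _).
by rewrite -[1 - _]opprB [LHS]exprNn -mul_polyC polyC_exp polyCN polyC1.
Qed.

Lemma size_ext_poly : size ext_poly = n.+1.
Proof.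
have gm : szego_coef m != 0 by rewrite szego_coefm mulf_neq0 ?invr_eq0 ?pnatr_eq0 // /n /k addnS.
have sg : size szego = m.+1 by rewrite size_poly_eq.
have g0 : szego != 0 by rewrite -size_poly_eq0 sg.
rewrite ext_polyE size_scale ?signr_eq0 // mulrC size_Mmonic //; last by rewrite monic_exp ?monicXsubC.
by rewrite sg size_exp_XsubC addnS /= /n.
Qed.

Lemma lead_coef_ext_poly : lead_coef ext_poly = (-1) ^+ k * (k%:R / n%:R).
Proof.
have gm : szego_coef m != 0 by rewrite szego_coefm mulf_neq0 ?invr_eq0 ?pnatr_eq0 // /n /k addnS.
have sg : size szego = m.+1 by rewrite size_poly_eq.
rewrite ext_polyE lead_coefZ lead_coef_monicM //; last by rewrite monic_exp ?monicXsubC.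
by rewrite /lead_coef sg /= coef_poly ltnSn szego_coefm.
Qed.

Lemma ext_poly_coef0 : ext_poly`_0 = 1.
Proof.
by rewrite /ext_poly coef0M coef_1subXn coef_poly /= bin0 szego_coef0 !mul1r.
Qed.

End ExtremalPoly.

(** * Height and discrepancy of the extremal polynomials *)

Section Sharpness.
Context {R : realType}.
Implicit Types (k l m n : nat).

Lemma cabs_real (x : R) : cabs x%:C%C = `|x|.
Proof. by rewrite /cabs /= expr0n addr0 sqrtr_sqr. Qed.

Lemma sqr_sum_le n (f : 'I_n -> R) : (\sum_i f i) ^+ 2 <= n%:R * \sum_i f i ^+ 2.
Proof.
set S := \sum_i f i; set Q := \sum_i _.
case: n f @S @Q => [|n] f S Q; first by rewrite /S big_ord0 expr0n /= mul0r.
have nR : 0 < n.+1%:R :> R by rewrite ltr0n.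
have : 0 <= \sum_(i < n.+1) (n.+1%:R * f i - S) ^+ 2 by apply: sumr_ge0 => i _; apply: sqr_ge0.
have -> : \sum_(i < n.+1) (n.+1%:R * f i - S) ^+ 2 = n.+1%:R * (n.+1%:R * Q - S ^+ 2).
  rewrite (eq_bigr (fun i => n.+1%:R ^+ 2 * f i ^+ 2 - 2 * n.+1%:R * S * f i + S ^+ 2)) => [|i _]; last by ring.
  by rewrite !big_split /= sumrN -!mulr_sumr sum_grid_const -/S -/Q; ring.
by rewrite pmulr_rge0 // subr_ge0.
Qed.

Lemma cabs_horner_le (p : {poly R}) (z : R[i]) : cabs z = 1 ->
  cabs (map_poly (real_complex R) p).[z] <= \sum_(i < size p) `|p`_i|.
Proof.
move=> z1; rewrite horner_coef size_map_poly.
elim/big_ind2: _ => [|x x' y y' h h'|i _].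
- by rewrite cabsE ComplexField.Normc.normc0.
- by rewrite cabsE; apply: (le_trans (le_normcD _ _)); rewrite -!cabsE lerD.
- rewrite coef_map cabsM cabs_real; have -> : cabs (z ^+ i) = 1; last by rewrite mulr1.
  elim: (nat_of_ord i) => [|k IH]; first by rewrite expr0 cabsE ComplexField.Normc.normc1.
  by rewrite exprS cabsM z1 IH mulr1.
Qed.

Lemma mup_prod_XsubC (F : fieldType) (x : F) (s : seq F) :
  mup x (\prod_(y <- s) ('X - y%:P)) = count_mem x s.
Proof.
elim: s => [|y s IH]; first by rewrite big_nil mupNroot // /root hornerC oner_eq0.
rewrite big_cons mupM ?polyXsubC_eq0 //; last by rewrite monic_neq0 // monic_prod_XsubC.
by rewrite IH -[X in mup x X]expr1 mup_XsubCX /=; case: eqP.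
Qed.

Lemma Nroots_multiplicity (f : {poly R[i]}) k : f != 0 ->
  ('X - 1%:P) ^+ k %| f -> (k <= Nroots f 0 0)%N.
Proof.
move=> f0; rewrite (polyrootsE f) dvdpZr ?lead_coef_eq0 // => h.
apply: (@leq_trans (count_mem 1 (polyroots f))).
  by rewrite -mup_prod_XsubC mup_geq // monic_neq0 // monic_prod_XsubC.
rewrite /Nroots -(polyrootsE f); apply: sub_count => z /= /eqP ->; apply/asboolP; exists 0.
split; first by rewrite lexx.
by rewrite cabsE ComplexField.Normc.normc1 e2piE mulr0 cis0 mulr1.
Qed.

(** The degenerate arc at angle [0] has length zero. The bound [1] on all excesses makes the
    supremum meaningful. *)
Lemma discrepancy_ge_Nroots (f : {poly R[i]}) : f != 0 ->
  (Nroots f 0 0)%:R / (pdeg f)%:R <= discrepancy f.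
Proof.
move=> f0; apply: ub_le_sup; last first.
  exists 0, 0; split; [exact: lexx | lra | by rewrite !subr0].
exists 1 => _ [al [be [ab _ ->]]].
have h : (Nroots f al be <= pdeg f)%N by rewrite -size_polyroots // count_size.
apply: (@le_trans _ _ ((Nroots f al be)%:R / (pdeg f)%:R)).
  by rewrite gerBl subr_ge0.
case: (posnP (pdeg f)) => [->|n0]; first by rewrite invr0 mulr0.
by rewrite ler_pdivrMr ?ltr0n // mul1r ler_nat.
Qed.

Section ExtremalHeight.
Variables kp m : nat.
Let k := kp.+1.
Let n := (m + k)%N.
Let f := map_poly (real_complex R) (ext_poly kp m).

Lemma pdeg_ext : pdeg f = n.
Proof. by rewrite /pdeg size_map_poly size_ext_poly. Qed.

Lemma coef0_ext : f`_0 = 1.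
Proof. by rewrite coef_map ext_poly_coef0. Qed.

Lemma ext_neq0 : f != 0.
Proof. by apply: contra_neq (oner_neq0 R[i]) => f0; rewrite -coef0_ext f0 coef0. Qed.

Lemma Nroots_ext : (k <= Nroots f 0 0)%N.
Proof.
apply: Nroots_multiplicity; first exact: ext_neq0.
have -> : f = ((-1) ^+ k)%:C%C *: (('X - 1%:P) ^+ k * map_poly (real_complex R) (szego kp m)).
  rewrite /f ext_polyE map_polyZ rmorphM /=; congr (_ *: (_ * _)).
  by rewrite (rmorphXn (map_poly (real_complex R))) /= map_polyXsubC.
rewrite dvdpZr ?dvdp_mulr //.
by rewrite -nsq_eq0 nsq_real sqrr_sign oner_neq0.
Qed.

(** The maximum on the circle is at most the sum of the moduli of the coefficients, hence at most
    [sqrt(n+1)] times the [l^2] norm by Cauchy-Schwarz; the end coefficients have product of modulus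
    [k/n]. *)
Lemma height_ext : (0 < m)%N ->
  height f <= ln (n.+1%:R * (1 + k%:R / m%:R) ^+ k * (n%:R / k%:R)) / (2 * n%:R).
Proof.
move=> m0; rewrite /height pdeg_ext.
have nR : 0 < n%:R :> R by rewrite ltr0n /n /k addnS.
have kR : 0 < k%:R :> R by rewrite ltr0n.
have mR : 0 < m%:R :> R by rewrite ltr0n.
have cE : cabs (f`_0 * lead_coef f) = k%:R / n%:R.
  rewrite coef0_ext mul1r lead_coef_map lead_coef_ext_poly cabs_real normrM normrX normrN1 expr1n mul1r.
  by rewrite ger0_norm // divr_ge0 // ltW.
have c0 : 0 < k%:R / n%:R :> R by rewrite divr_gt0.
rewrite cE; set B := (1 + _ / _) ^+ k.
have B0 : 0 < B by rewrite exprn_gt0 // addr_gt0 // divr_gt0.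
have S0 := supnorm_circle_gt0 f ext_neq0.
have SB : supnorm_circle f <= Num.sqrt (n.+1%:R * B).
  apply: ge_sup; first by exists (cabs f.[1]), 1; rewrite cabsE ComplexField.Normc.normc1.
  move=> _ [z [z1 ->]]; apply: (le_trans (cabs_horner_le _ _ z1)).
  rewrite size_ext_poly -/k -/n.
  have s0 : 0 <= \sum_(i < n.+1) `|(ext_poly kp m)`_i| :> R by apply: sumr_ge0.
  rewrite -[leLHS](ger0_norm s0) -sqrtr_sqr; apply: ler_wsqrtr.
  apply: (le_trans (sqr_sum_le _ _)); rewrite ler_wpM2l //.
  under eq_bigr do rewrite real_normK ?num_real //.
  exact: sum_sqr_ext_poly_le.
have -> : ln (n.+1%:R * B * (n%:R / k%:R)) / (2 * n%:R) =
   n%:R^-1 * (ln (Num.sqrt (n.+1%:R * B) / Num.sqrt (k%:R / n%:R))).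
  have nB : 0 < n.+1%:R * B by rewrite mulr_gt0.
  have sq (x : R) : 0 < x -> ln x = 2 * ln (Num.sqrt x).
    by move=> x0; rewrite -{1}(sqr_sqrtr (ltW x0)) lnXn ?sqrtr_gt0 // mulr_natl.
  rewrite ln_div ?posrE ?sqrtr_gt0 // lnM ?posrE ?divr_gt0 // (sq (n.+1%:R * B)) //.
  have -> : n%:R / k%:R = (k%:R / n%:R)^-1 :> R by rewrite invf_div.
  rewrite lnV ?posrE // (sq (k%:R / n%:R)) //.
  by field; rewrite gt_eqF.
apply: ler_wpM2l; first by rewrite invr_ge0 ltW.
have c1 : 0 < Num.sqrt (k%:R / n%:R) :> R by rewrite sqrtr_gt0.
have nB : 0 < Num.sqrt (n.+1%:R * B) by rewrite sqrtr_gt0 mulr_gt0.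
by rewrite ler_ln ?posrE ?divr_gt0 // ler_pM2r // invr_gt0.
Qed.

End ExtremalHeight.

Lemma discrepancy_sharp (c : R) : c < Num.sqrt 2 ->
  exists f : {poly R[i]}, [/\ (1 <= pdeg f)%N, f`_0 != 0 &
    c * Num.sqrt (height f) < discrepancy f].
Proof.
wlog c1 : c / 1 <= c.
  move=> W c2; have [||f [f1 f2 f3]] := W (Num.max c 1).
  - by rewrite le_max lexx orbT.
  - by rewrite gt_max c2 -[ltLHS](sqrtr1 R) ltr_sqrt // ltr1n.
  exists f; split=> //; apply: le_lt_trans f3.
  by rewrite ler_wpM2r ?sqrtr_ge0 // le_max lexx.
move=> c2; have c0 : 0 < c by lra.
pose eta := 1 - c ^+ 2 / 2.
have eta0 : 0 < eta.
  have : c ^+ 2 < 2.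
    rewrite -[ltRHS](@sqr_sqrtr R 2) // ltrXn2r ?nnegrE ?sqrtr_ge0 ?(ltW c0) //.
  rewrite /eta; lra.
have cE : c ^+ 2 = 2 * (1 - eta) by rewrite /eta; field.
have eta1 : eta < 1 by have := exprn_gt0 2 c0; lra.
clearbody eta.
(* [e] is the ratio [m/k] and [d = e + 1] the ratio [n/k]. They stay fixed while [K] grows, and half
   of the slack [eta] pays for [1/e]. *)
pose e := (Num.truncn (2 / eta)).+1.
have eR : 0 < e%:R :> R by rewrite ltr0n.
have ee : e%:R^-1 <= eta / 2.
  rewrite -[leRHS]invrK lef_pV2 ?posrE ?invr_gt0 ?divr_gt0 // invf_div.
  by rewrite ltW // truncnS_gt.
pose d := e.+1%:R : R.
have dE : d = e%:R + 1 by rewrite /d -natr1.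
have d0 : 0 < d by rewrite ltr0n.
pose L := ln (d * (d + 1)).
have L0 : 0 <= L by rewrite ln_ge0 //; nra.
(* With [k = K^2] the logarithmic terms are at most [(2 + L) K], negligible against [k]; the other
   half of [eta] pays for them. *)
pose K := (Num.truncn (2 * d * (2 + L) / eta)).+1.
have KR : 0 < K%:R :> R by rewrite ltr0n.
have K1 : 1 <= K%:R :> R by rewrite ler1n.
have Kb : d * (2 + L) / K%:R < eta / 2.
  rewrite ltr_pdivrMr // -ltr_pdivrMl ?divr_gt0 //.
  apply: le_lt_trans (truncnS_gt _); rewrite le_eqVlt; apply/orP; left; apply/eqP.
  by field; rewrite gt_eqF.
pose kp := (K ^ 2).-1.
have kE : kp.+1 = (K ^ 2)%N by rewrite prednK // expn_gt0.
pose m := (K ^ 2 * e)%N.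
have m0 : (0 < m)%N by rewrite muln_gt0 expn_gt0.
have nE : (m + kp.+1)%:R = K%:R ^+ 2 * d :> R.
  by rewrite kE /m addnC -mulnS natrM natrX.
have kR : kp.+1%:R = K%:R ^+ 2 :> R by rewrite kE natrX.
have k0 : 0 < K%:R ^+ 2 :> R by rewrite exprn_gt0.
set f := map_poly (real_complex R) (ext_poly kp m); exists f.
split; [by rewrite pdeg_ext addnS | by rewrite coef0_ext oner_neq0 | ].
have Dge : d^-1 <= discrepancy f.
  apply: le_trans (discrepancy_ge_Nroots f (ext_neq0 kp m)).
  rewrite pdeg_ext nE invfM mulrA -[leLHS]mul1r ler_pM2r ?invr_gt0 //.
  rewrite ler_pdivlMr // mul1r -kR ler_nat; exact: Nroots_ext.
apply: lt_le_trans Dge.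
(* [Num.sqrt] is [0] at a nonpositive height, while the discrepancy is positive. *)
case: (leP (height f) 0) => [h|h0].
  by rewrite ler0_sqrtr // mulr0 invr_gt0.
have dV : 0 <= d^-1 by rewrite invr_ge0 ltW.
rewrite -ltr_sqr ?nnegrE ?mulr_ge0 ?sqrtr_ge0 ?(ltW c0) //.
rewrite exprMn sqr_sqrtr ?(ltW h0) //.
have H := height_ext kp m m0; rewrite -/f nE kR in H.
have n1E : (m + kp.+1).+1%:R = K%:R ^+ 2 * d + 1 :> R by rewrite -natr1 nE.
have mE : K%:R ^+ 2 / m%:R = e%:R^-1 :> R.
  by rewrite /m natrM natrX invfM mulrA divff ?mul1r // gt_eqF.
have ndE : K%:R ^+ 2 * d / K%:R ^+ 2 = d by rewrite mulrAC divff ?mul1r // gt_eqF.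
rewrite n1E mE ndE in H.
have lnB : ln ((K%:R ^+ 2 * d + 1) * (1 + e%:R^-1) ^+ kp.+1 * d) <=
    (2 + L) * K%:R + K%:R ^+ 2 / e%:R.
  have u0 : 0 < K%:R ^+ 2 * d + 1 by rewrite addr_gt0 // mulr_gt0.
  have v0 : 0 < 1 + e%:R^-1 :> R by rewrite addr_gt0 // invr_gt0.
  rewrite mulrAC.
  rewrite lnM ?posrE ?exprn_gt0 ?mulr_gt0 // lerD //.
    apply: (@le_trans _ _ (ln (K%:R ^+ 2 * (d * (d + 1))))).
      have k1 : 1 <= K%:R ^+ 2 :> R by rewrite exprn_ege1.
      rewrite ler_ln ?posrE ?mulr_gt0 //; last by lra.
      nra.
    rewrite lnM ?posrE ?mulr_gt0 //; last by lra.
    rewrite lnXn // -/L mulrDl.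
    have h1 : ln K%:R <= K%:R :> R by rewrite ltW // ln_sublinear.
    rewrite lerD //; first by rewrite -(mulr_natl (ln _)) ler_pM2l.
    by rewrite ler_peMr.
  rewrite lnXn // -(mulr_natl (ln _)) kR ler_pM2l //.
  by apply: le_ln1Dx; have : 0 < e%:R^-1 :> R by [rewrite invr_gt0]; lra.
have H2 : height f <= ((2 + L) * K%:R + K%:R ^+ 2 / e%:R) / (2 * (K%:R ^+ 2 * d)).
  by apply: (le_trans H); rewrite ler_pM2r // invr_gt0 !mulr_gt0.
apply: (@le_lt_trans _ _ (c ^+ 2 * (((2 + L) * K%:R + K%:R ^+ 2 / e%:R) / (2 * (K%:R ^+ 2 * d))))).
  by rewrite ler_pM2l // exprn_gt0.
(* After scaling by [d^2] the main term is [(1 - eta) d / e = (1 - eta) (1 + 1/e)], to be compared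
   with [1]. *)
have -> : c ^+ 2 * (((2 + L) * K%:R + K%:R ^+ 2 / e%:R) / (2 * (K%:R ^+ 2 * d))) =
   ((1 - eta) * (d * (2 + L) / K%:R) + (1 - eta) * (1 + e%:R^-1)) / d ^+ 2.
  rewrite cE dE; field; rewrite !gt_eqF //=; lra.
rewrite ltr_pdivrMr ?exprn_gt0 // -exprMn mulVf ?expr1n ?gt_eqF //.
have e10 : 0 < 1 - eta by lra.
have h1 : (1 - eta) * (d * (2 + L) / K%:R) < eta / 2.
  apply: le_lt_trans Kb; rewrite ler_piMl //; last by lra.
  by rewrite !mulr_ge0 ?invr_ge0 ?addr_ge0 // ltW.
have h2 : (1 - eta) * (1 + e%:R^-1) <= 1 - eta + e%:R^-1.
  have : 0 < e%:R^-1 :> R by rewrite invr_gt0.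
  nra.
lra.
Qed.

End Sharpness.

Theorem theorem1p1 (R : realType) :
  (forall f : {poly R[i]}, (1 <= pdeg f)%N -> f`_0 != 0 ->
     discrepancy f <= Num.sqrt 2 * Num.sqrt (height f)) /\
  (forall c : R, c < Num.sqrt 2 ->
     exists f : {poly R[i]}, [/\ (1 <= pdeg f)%N, f`_0 != 0 &
       c * Num.sqrt (height f) < discrepancy f]).
Proof.
split; [exact: discrepancy_le | exact: discrepancy_sharp].
Qed.
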